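(* Let $q \geq 5$ be a prime power and let $\mathcal{X}$ be a plane curve of degree $q-1$ defined over $\mathbb{F}_q$ without $\mathbb{F}_q$-linear components. If $\mathrm{N}_q(\mathcal{X}) = (q-1)^2$, then there exist $\alpha, \beta, \gamma \in \mathbb{F}_q^{*}$ with $\alpha + \beta + \gamma = 0$ such that $\mathcal{X}$ is projectively equivalent over $\mathbb{F}_q$ to the curve $\mathcal{C}_{(\alpha,\beta,\gamma)} : \alpha X^{q-1} + \beta Y^{q-1} + \gamma Z^{q-1} = 0$.
   Context: A plane curve is the zero locus in $\mathbb{P}^2(\overline{\mathbb{F}}_q)$ of a homogeneous polynomial; it is defined over $\mathbb{F}_q$ if some nonzero scalar multiple of its equation has coefficients in $\mathbb{F}_q$. ''Without $\mathbb{F}_q$-linear components'' means no line defined over $\mathbb{F}_q$ is a component of the curve. $\mathrm{N}_q(\mathcal{X})$ denotes the number of points of $\mathcal{X}$ in $\mathbb{P}^2(\mathbb{F}_q)$. Two curves are projectively equivalent over $\mathbb{F}_q$ if one is the image of the other under a projectivity given by a matrix in $\mathrm{GL}_3(\mathbb{F}_q)$. *)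

(* Defs.v *)
From HB Require Import structures.
From mathcomp Require Import all_boot all_order all_algebra all_field.
From mathcomp Require Import mpoly.
Set Implicit Arguments. Unset Strict Implicit. Unset Printing Implicit Defensive.
Import GRing.Theory.
Local Open Scope ring_scope.

(* Plane curves over F = F_q are given by their (nonzero, homogeneous)
   defining polynomials in {mpoly F[3]} (variables 'X_0, 'X_1, 'X_2 = X, Y, Z),
   identified up to a nonzero scalar. *)

Definition plane_curve (F : fieldType) (d : nat) (f : {mpoly F[3]}) : Prop :=
  f != 0 /\ f \is d.-homog.

Definition has_Fq_linear_component (F : fieldType) (f : {mpoly F[3]}) : Prop :=
  exists (l g : {mpoly F[3]}), l != 0 /\ l \is 1.-homog /\ f = l * g.

(* Number of F_q-rational points of P^2 on the curve: number of nonzero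
   vectors of F^3 on which f vanishes, divided by #|F^*| = q - 1. *)
Definition Nq (F : finFieldType) (f : {mpoly F[3]}) : nat :=
  #|[set v : {ffun 'I_3 -> F} | (v != [ffun => 0]) && (f.@[v] == 0)]| %/ (#|F| - 1).

Definition proj_transform (F : fieldType) (M : 'M[F]_3) (f : {mpoly F[3]})
  : {mpoly F[3]} :=
  f \mPo [tuple \sum_(j < 3) M i j *: 'X_j | i < 3].

Definition proj_equiv (F : fieldType) (f g : {mpoly F[3]}) : Prop :=
  exists (M : 'M[F]_3) (c : F),
    M \in unitmx /\ c != 0 /\ proj_transform M f = c *: g.

Definition fermat_curve (F : fieldType) (e : nat) (a b c : F) : {mpoly F[3]} :=
  a *: 'X_0 ^+ e + b *: 'X_1 ^+ e + c *: 'X_2 ^+ e.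

(* Main.v *)
Require Import Defs.
From HB Require Import structures.
From mathcomp Require Import all_boot all_order all_algebra all_field.
From mathcomp Require Import mpoly.
From mathcomp Require Import zify ring.
(* Let q = #|F|, let B be the set of rational points off the curve, so that
   #|B| = 3q, and weight B by the nonzero values of f. Since a form of degree
   less than 3(q - 1) sums to 0 over F^3, this weight is orthogonal to all forms
   of degree q - 1, and it sums to 0 over every line; as f contains no line,
   every line meets B in at least two points.

   Multiplying by a linear form trades one degree of orthogonality for the
   deletion of the points of B on a line. A set carrying a nowhere zero weight
   orthogonal to the forms of degree k lies on a line if it has at most 2k + 1
   points, and on a conic if it has fewer than 3k points. Deleting at most three
   lines rich in points of B, whose existence follows by counting incidences,
   brings B below these thresholds, except for one configuration with q = 7 that
   is excluded by computing its weight. Hence B lies on four lines, and then on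
   three, which must be the sides of a triangle. In coordinates adapted to the
   triangle f vanishes on (F^* )^3, which leaves only the monomials X^(q-1),
   Y^(q-1) and Z^(q-1). *)

(** The obstacle is that B is slightly too large: a weight orthogonal to degree k = q - 1 forces a
    conic only below 3(q - 1) points, and B has 3q. Deleting a line lowers k by one, hence the
    threshold 3k by three. So one deletion suffices if the line has at least 7 points of B, and two
    suffice if they remove at least 10 together (6 + 4 or 5 + 5). Let i be the number of points of B
    on a line. Summing products (i - r)(i - s) over all lines yields such lines when q > 6, or else
    leaves every line with at most 5 points and q <= 10. For q = 5 the threshold 2k + 1 does the
    work. That every line has two points of B is also a tool for locating points: a line whose
    points of B are confined to two given points contains both of them. This is how the
    intersections of covering lines are shown to be in B, which makes B too large for a cover that
    really needs four lines. *)

Set Implicit Arguments. Unset Strict Implicit. Unset Printing Implicit Defensive.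
Import GRing.Theory.
Local Open Scope ring_scope.

(** * Points, lines and cross products in the projective plane over F *)

Section ProjectivePlane.
Variable F : finFieldType.
Local Notation V := {ffun 'I_3 -> F}.
Implicit Types (a b u v x y : V) (c : F).

Definition dot a v : F := \sum_i a i * v i.

Definition scale c v : V := [ffun i => c * v i].

Definition vec3 (r s t : F) : V := [ffun i : 'I_3 => [:: r; s; t]`_i].

Definition cross u v : V :=
  vec3 (u 1 * v 2%:R - u 2%:R * v 1)
       (u 2%:R * v 0 - u 0 * v 2%:R)
       (u 0 * v 1 - u 1 * v 0).

Lemma dotE a v : dot a v = a 0 * v 0 + a 1 * v 1 + a 2%:R * v 2%:R.
Proof.
rewrite /dot !big_ord_recl big_ord0 addr0 addrA.
by congr (_ * _ + _ * _ + _ * _); congr (_ _); apply: val_inj.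
Qed.

Lemma vec3E r s t : (vec3 r s t 0 = r) * (vec3 r s t 1 = s) * (vec3 r s t 2%:R = t).
Proof. by rewrite !ffunE. Qed.

Lemma vecP u v : u 0 = v 0 -> u 1 = v 1 -> u 2%:R = v 2%:R -> u = v.
Proof.
move=> e0 e1 e2; apply/ffunP => -[[|[|[|//]]] p].
- by rewrite (_ : Ordinal p = 0) //; apply: val_inj.
- by rewrite (_ : Ordinal p = 1) //; apply: val_inj.
- by rewrite (_ : Ordinal p = 2%:R) //; apply: val_inj.
Qed.

Lemma dotC a v : dot a v = dot v a.
Proof. by rewrite !dotE; ring. Qed.

Lemma dotDr a u v : dot a (u + v) = dot a u + dot a v.
Proof. by rewrite !dotE !ffunE; ring. Qed.

Lemma dotZr a c v : dot a (scale c v) = c * dot a v.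
Proof. by rewrite !dotE !ffunE; ring. Qed.

Lemma dotZl a c v : dot (scale c a) v = c * dot a v.
Proof. by rewrite !dotE !ffunE; ring. Qed.

Lemma dot0l v : dot 0 v = 0.
Proof. by rewrite !dotE !ffunE; ring. Qed.

Lemma dot0r v : dot v 0 = 0.
Proof. by rewrite dotC dot0l. Qed.

Lemma dot_crossl u v : dot (cross u v) u = 0.
Proof. by rewrite dotE !vec3E; ring. Qed.

Lemma dot_crossr u v : dot (cross u v) v = 0.
Proof. by rewrite dotE !vec3E; ring. Qed.

Lemma vec_neq0 v : v != 0 -> [|| v 0 != 0, v 1 != 0 | v 2%:R != 0].
Proof.
apply: contraR; rewrite !negb_or !negbK => /and3P[/eqP e0 /eqP e1 /eqP e2].
by apply/eqP; apply: vecP; rewrite ffunE.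
Qed.

Lemma scale_eq0 c v : (scale c v == 0) = (c == 0) || (v == 0).
Proof.
apply/eqP/orP => [/ffunP e | [/eqP -> | /eqP ->]].
- have [_|c0] := eqVneq c 0; [by left | right; apply/eqP/ffunP => i].
  by move: (e i); rewrite !ffunE => /eqP; rewrite mulf_eq0 (negPf c0) => /eqP.
- by apply/ffunP => i; rewrite !ffunE mul0r.
- by apply/ffunP => i; rewrite !ffunE mulr0.
Qed.

Lemma cross_eq0 u v : v != 0 -> cross u v = 0 -> exists c, u = scale c v.
Proof.
move=> /vec_neq0 v0 /ffunP e.
have := e 0; have := e 1; have := e 2%:R; rewrite !vec3E !ffunE.
move=> /subr0_eq e2 /subr0_eq e1 /subr0_eq e0.
case/or3P: v0 => v0.
- exists (u 0 / v 0); apply: vecP; rewrite ffunE.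
  + by rewrite mulfVK.
  + by rewrite mulrAC e2 mulfK.
  + by rewrite mulrAC -e1 mulfK.
- exists (u 1 / v 1); apply: vecP; rewrite ffunE.
  + by rewrite mulrAC -e2 mulfK.
  + by rewrite mulfVK.
  + by rewrite mulrAC e0 mulfK.
- exists (u 2%:R / v 2%:R); apply: vecP; rewrite ffunE.
  + by rewrite mulrAC e1 mulfK.
  + by rewrite mulrAC -e0 mulfK.
  + by rewrite mulfVK.
Qed.

Lemma ortho_cross a u v : cross u v != 0 -> dot a u = 0 -> dot a v = 0 ->
  exists c, a = scale c (cross u v).
Proof.
move=> uv0 au av; apply: cross_eq0 => //.
(* Triple product: u (a.v) - v (a.u) is the cross product of a with [cross u v]. *)
have e i : u i * dot a v - v i * dot a u = 0 by rewrite au av !mulr0 subr0.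
by apply: vecP; rewrite [RHS]ffunE;
   [rewrite -[RHS](e 0) | rewrite -[RHS](e 1) | rewrite -[RHS](e 2%:R)];
   rewrite !vec3E !dotE; ring.
Qed.

(* Points and lines of the projective plane are both represented by the
   vectors whose first nonzero coordinate is 1. *)
Definition points : {set V} :=
  [set v : V | (v 0 == 1) || (v 0 == 0) && ((v 1 == 1) || (v 1 == 0) && (v 2%:R == 1))].

Lemma points_neq0 v : v \in points -> v != 0.
Proof.
apply: contraTneq => ->; rewrite inE !ffunE.
by rewrite eq_sym oner_eq0 eqxx.
Qed.

Lemma points_scale c u : u \in points -> scale c u \in points -> c = 1.
Proof.
have e01 : (0 == 1 :> F) = false by rewrite eq_sym oner_eq0.
rewrite !inE !ffunE.
case/orP=> [/eqP -> | /andP[/eqP ->]].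
  rewrite mulr1; case/orP => [/eqP -> // | /andP[/eqP ->]].
  by rewrite !mul0r eqxx e01.
rewrite mulr0 eqxx e01 /=.
case/orP=> [/eqP -> | /andP[/eqP ->]].
  rewrite mulr1; case/orP => [/eqP -> // | /andP[/eqP ->]].
  by rewrite mul0r e01.
by move=> /eqP ->; rewrite mulr0 mulr1 eqxx e01 /= => /eqP.
Qed.

Lemma scaleA c d v : scale c (scale d v) = scale (c * d) v.
Proof. by apply/ffunP => i; rewrite !ffunE mulrA. Qed.

Lemma scale1 v : scale 1 v = v.
Proof. by apply/ffunP => i; rewrite !ffunE mul1r. Qed.

Lemma normalize v : v != 0 -> exists c u, [/\ c != 0, u \in points & v = scale c u].
Proof.
move=> v0.
suff [c c0 uP] : exists2 c, c != 0 & scale c^-1 v \in points.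
  by exists c, (scale c^-1 v); split; rewrite // scaleA divff // scale1.
have [e0|n0] := eqVneq (v 0) 0; last first.
  by exists (v 0) => //; rewrite inE !ffunE mulVf // eqxx.
have [e1|n1] := eqVneq (v 1) 0; last first.
  by exists (v 1) => //; rewrite inE !ffunE e0 mulr0 mulVf // !eqxx orbT.
exists (v 2%:R); first by have := vec_neq0 v0; rewrite e0 e1 !eqxx.
have := vec_neq0 v0; rewrite e0 e1 !eqxx /= => n2.
by rewrite inE !ffunE e0 e1 mulr0 mulVf // !eqxx !orbT.
Qed.

Lemma points_cross_neq0 u v : u \in points -> v \in points -> u != v -> cross u v != 0.
Proof.
move=> uP vP; apply: contraNneq => /(cross_eq0 (points_neq0 vP)) [c ec].
by move: (uP); rewrite ec => /(points_scale vP) ->; rewrite scale1.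
Qed.

Lemma line_through u v : u \in points -> v \in points -> u != v ->
  exists2 a, a \in points &
    forall b, b \in points -> (dot b u == 0) && (dot b v == 0) = (b == a).
Proof.
move=> uP vP uv; have n0 := points_cross_neq0 uP vP uv.
have [c [a [c0 aP e]]] := normalize n0; exists a => // b bP.
apply/andP/eqP => [[/eqP bu /eqP bv] | ->].
  have [d ed] := ortho_cross n0 bu bv.
  by move: (bP); rewrite ed e scaleA => /(points_scale aP) ->; rewrite scale1.
have := dot_crossl u v; have := dot_crossr u v; rewrite e !dotZl.
by move=> /eqP; rewrite mulf_eq0 (negPf c0) /= => -> /eqP; rewrite mulf_eq0 (negPf c0) /= => ->.
Qed.

Lemma line_through_exists u v : u \in points -> v \in points ->
  exists2 a, a \in points & dot a u = 0 /\ dot a v = 0.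
Proof.
move=> uP vP; have [<-|uv] := eqVneq u v.
  (* For u = v any line through u will do; y is a coordinate vector not proportional to u. *)
  pose y : V := if u 0 == 0 then vec3 1 0 0 else vec3 0 0 1.
  have yu : cross u y != 0.
    apply/eqP => /ffunP e; have := points_neq0 uP; case/negP.
    have := e 0; have := e 1; have := e 2%:R; rewrite /y; case: (eqVneq (u 0) 0) => [u0|u0].
      rewrite !vec3E !ffunE u0 !(mulr0, mulr1, mul0r, mul1r, subr0, sub0r).
      by move=> /eqP; rewrite oppr_eq0 => /eqP e1 e2 _; apply/eqP/vecP; rewrite ?ffunE.
    rewrite !vec3E !ffunE !(mulr0, mulr1, mul0r, mul1r, subr0, sub0r) => _ /eqP.
    by rewrite oppr_eq0 (negPf u0).
  have [c [a [c0 aP ea]]] := normalize yu; exists a => //.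
  by have := dot_crossl u y; rewrite ea dotZl => /eqP; rewrite mulf_eq0 (negPf c0) => /eqP->.
have [a aP /(_ a aP)] := line_through uP vP uv.
by rewrite eqxx => /andP[/eqP ? /eqP ?]; exists a.
Qed.

Lemma scale_inj (Z : {set V}) : Z \subset points ->
  {in setX [set~ (0 : F)] Z &, injective (fun p : F * V => scale p.1 p.2)}.
Proof.
move=> /subsetP ZP [c u] [d v]; rewrite !in_setX !in_setC1 /=.
move=> /andP[c0 /ZP uP] /andP[d0 /ZP vP] e.
have eu : u = scale (c^-1 * d) v by rewrite -scaleA -e scaleA mulVf // scale1.
have e1 : c^-1 * d = 1 by apply: (points_scale vP); rewrite -eu.
rewrite e1 scale1 in eu; congr (_, _) => //.
by rewrite -[c]mulr1 -e1 mulrA mulfV // mul1r.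
Qed.

(** A nonzero vector is c u for exactly one nonzero scalar c and one normalized u. This serves to
    count the points of the plane, of a line and of the curve. *)
Lemma card_scale_closed (Z : {set V}) : 0 \notin Z ->
  (forall c v, c != 0 -> v \in Z -> scale c v \in Z) ->
  #|Z| = (#|F|.-1 * #|Z :&: points|)%N.
Proof.
move=> Z0 Zs.
have eZ : Z = [set scale p.1 p.2 | p in setX [set~ 0] (Z :&: points)].
  apply/setP => v; apply/idP/imsetP => [vZ | [[c u]]].
    have v0 : v != 0 by apply: contraNneq Z0 => <-.
    have [c [u [c0 uP ev]]] := normalize v0.
    exists (c, u) => //; rewrite !inE c0 /=.
    rewrite inE in uP; rewrite uP andbT.
    have := Zs c^-1 v; rewrite invr_eq0 => /(_ c0 vZ).
    by rewrite ev scaleA mulVf // scale1.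
  by rewrite in_setX in_setC1 in_setI => /andP[c0 /andP[uZ _]] ->; apply: Zs.
rewrite [in LHS]eZ card_in_imset; first by rewrite cardsX cardsC1.
exact: scale_inj (subsetIr _ _).
Qed.

Lemma card_space : #|{: V}| = (#|F| ^ 3)%N.
Proof. by rewrite card_ffun card_ord. Qed.

Lemma dot_neq0 a : a != 0 -> exists e, dot a e = 1.
Proof.
case/vec_neq0/or3P => a0.
- by exists (vec3 (a 0)^-1 0 0); rewrite dotE !vec3E mulfV // !mulr0 !addr0.
- by exists (vec3 0 (a 1)^-1 0); rewrite dotE !vec3E mulfV // !mulr0 addr0 add0r.
- by exists (vec3 0 0 (a 2%:R)^-1); rewrite dotE !vec3E mulfV // !mulr0 !add0r.
Qed.

Lemma card_dot_eq0 a : a != 0 -> #|[set v | dot a v == 0]| = (#|F| ^ 2)%N.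
Proof.
move=> a0; have [e ae] := dot_neq0 a0.
have F0 : (0 < #|F|)%N by apply/card_gt0P; exists 0.
apply/eqP; rewrite -(eqn_pmul2r F0) -expnSr -card_space -[X in _ == X]cardsT.
pose h (p : V * F) : V := p.1 + scale p.2 e.
have -> : setT = [set h p | p in setX [set v | dot a v == 0] [set: F]].
  apply/setP => v; rewrite inE; apply/esym/imsetP.
  exists (v - scale (dot a v) e, dot a v); last by rewrite /h subrK.
  rewrite !inE andbT /= -(inj_eq (addIr (dot a (scale (dot a v) e)))) -dotDr subrK.
  by rewrite dotZr ae mulr1 add0r.
rewrite card_in_imset; first by rewrite cardsX cardsT.
move=> [u c] [v d]; rewrite !inE !andbT /= => /eqP au /eqP av; rewrite /h /= => e1.
have := congr1 (dot a) e1; rewrite !dotDr !dotZr au av ae !add0r !mulr1 => ecd.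
by move: e1; rewrite ecd => /addIr ->.
Qed.

Lemma card_points : (#|F|.-1 * #|points| = #|F| ^ 3 - 1)%N.
Proof.
rewrite -(_ : [set~ (0 : V)] :&: points = points); last first.
  by apply/setIidPr/subsetP => v /points_neq0; rewrite in_setC1.
rewrite -card_scale_closed ?cardsC1 ?card_space ?subn1 //; first by rewrite !inE eqxx.
by move=> c v c0; rewrite !in_setC1 scale_eq0 negb_or c0.
Qed.

Lemma card_line_points a : a \in points -> #|[set v in points | dot a v == 0]| = #|F|.+1.
Proof.
move=> /points_neq0 a0.
have F1 : (1 < #|F|)%N by have := finNzRing_gt1 F.
pose Z := [set v : V | dot a v == 0] :\ (0 : V).
have : #|Z| = (#|F| ^ 2 - 1)%N.
  by have := cardsD1 (0 : V) [set v : V | dot a v == 0]; rewrite inE dot0r eqxx card_dot_eq0 // /Z; lia.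
rewrite (card_scale_closed (Z := Z)).
- have -> : [set v in points | dot a v == 0] = Z :&: points.
    apply/setP => v; rewrite in_set in_setI in_setD1 (in_set (fun v => dot a v == 0)) [LHS]andbC.
    by case: (boolP (v \in points)) => [/points_neq0 -> | _]; rewrite ?andbT ?andbF.
  rewrite -subn1 (_ : #|F| ^ 2 - 1 = (#|F| - 1) * #|F|.+1)%N; last by nia.
  by move/eqP; rewrite eqn_pmul2l ?subn_gt0 // => /eqP.
- by rewrite !inE eqxx.
- by move=> c v c0; rewrite !in_setD1 !in_set dotZr mulf_eq0 (negPf c0) scale_eq0 negb_or c0.
Qed.

Lemma card_pencil v : v \in points -> #|[set a in points | dot a v == 0]| = #|F|.+1.
Proof.
move=> vP; rewrite -(card_line_points vP); congr #|pred_of_set _|.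
by apply/setP => a; rewrite !inE dotC.
Qed.

End ProjectivePlane.

(** * Quadratic forms as functions, and their linear factors *)

Section QuadraticForms.
Variable F : finFieldType.
Local Notation V := {ffun 'I_3 -> F}.
Implicit Types (a b u v x y : V) (g h : V -> F).

Definition zeros g : {set V} := [set v | g v == 0].

(** A sum of coordinates times linear forms: multiplying a weight by g then reduces to multiplying
    twice by linear forms, as in [dep_quadratic], and characteristic 2 needs no separate
    treatment. *)
Definition is_quadratic g := exists C : 'I_3 -> V, forall v, g v = \sum_i v i * dot (C i) v.

Lemma quadratic_mul a b : is_quadratic (fun v => dot a v * dot b v).
Proof.
exists (fun i => scale (a i) b) => v; rewrite {1}/dot mulr_suml.
by apply: eq_bigr => i _; rewrite dotZl mulrCA mulrA.
Qed.

Lemma quadratic_sub g h : is_quadratic g -> is_quadratic h -> is_quadratic (fun v => g v - h v).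
Proof.
move=> [C eC] [D eD]; exists (fun i => C i - D i) => v; rewrite eC eD -sumrB.
by apply: eq_bigr => i _; rewrite -mulrBr; congr (_ * _); rewrite !dotE !ffunE; ring.
Qed.

Lemma ord3_ind (P : 'I_3 -> Prop) : P 0 -> P 1 -> P 2%:R -> forall i, P i.
Proof.
move=> P0 P1 P2 [[|[|[|//]]] p].
- by rewrite (_ : Ordinal p = 0) //; apply: val_inj.
- by rewrite (_ : Ordinal p = 1) //; apply: val_inj.
- by rewrite (_ : Ordinal p = 2%:R) //; apply: val_inj.
Qed.

Lemma quadratic_polar g : is_quadratic g -> exists P : V -> V, forall r s u v,
  g (scale r u + scale s v) = r ^+ 2 * g u + r * s * dot (P u) v + s ^+ 2 * g v.
Proof.
move=> [C eC]; exists (fun u => [ffun j => dot (C j) u + \sum_i u i * C i j]).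
move=> r s u v; rewrite !eC !big_ord_recl !big_ord0 !dotE !ffunE.
rewrite !big_ord_recl !big_ord0.
have e0 : ord0 = 0 :> 'I_3 by apply: val_inj.
have e1 : lift ord0 ord0 = 1 :> 'I_3 by apply: val_inj.
have e2 : lift ord0 (lift ord0 ord0) = 2%:R :> 'I_3 by apply: val_inj.
by rewrite !dotE ?ffunE ?e2 ?e1 ?e0; ring.
Qed.

Lemma span_cross u v y : cross u v != 0 -> dot (cross u v) y = 0 ->
  exists r s, y = scale r u + scale s v.
Proof.
move=> n0 ny.
(* Cramer's rule: the two sides differ by at most the determinant of u, v, y (when i = j), which is
   zero by [ny]. *)
have e i j : cross u v i * y j = cross y v i * u j + cross u y i * v j.
  rewrite -[RHS]addr0 -(mulr0 (j == i)%:R) -ny dotE.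
  by elim/ord3_ind: i; elim/ord3_ind: j; rewrite !vec3E /=; ring.
have [i ni] : exists i, cross u v i != 0.
  by case/or3P: (vec_neq0 n0) => ni; [exists 0 | exists 1 | exists 2%:R].
exists (cross y v i / cross u v i), (cross u y i / cross u v i).
have sE r s j : (scale r u + scale s v) j = r * u j + s * v j by rewrite !ffunE.
by apply/ffunP => j; rewrite sE !(mulrAC _ _^-1) -mulrDl -e mulrC mulKf.
Qed.

Lemma line_span a u v y : u \in points F -> v \in points F -> u != v -> a != 0 ->
  dot a u = 0 -> dot a v = 0 -> dot a y = 0 -> exists r s, y = scale r u + scale s v.
Proof.
move=> uP vP uv a0 au av ay; have n0 := points_cross_neq0 uP vP uv.
apply: span_cross => //; have [c ec] := ortho_cross n0 au av.
move/eqP: ay; rewrite ec dotZl mulf_eq0 => /orP[/eqP c0|/eqP //].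
by move: a0; rewrite ec c0 scale_eq0 eqxx.
Qed.

(** On the line spanned by two zeros u, v, the form at r u + s v is p r s with p constant. A third
    zero has r and s nonzero, so p = 0. *)
Lemma quadratic_line g a (R : {set V}) : is_quadratic g -> a != 0 -> R \subset points F ->
  (2 < #|R|)%N -> R \subset zeros (dot a) -> R \subset zeros g ->
  forall y, dot a y = 0 -> g y = 0.
Proof.
move=> gq a0 /subsetP RP /card_gt2P[u [v [x [[uR vR xR] [uv vx xu]]]]].
move=> /subsetP Ra /subsetP Rg y ay.
have z0 t : t \in R -> (t \in points F) * (dot a t = 0) * (g t = 0).
  by move=> tR; have := Ra t tR; have := Rg t tR; rewrite !inE => /eqP -> /eqP ->; have := RP t tR; rewrite inE.
have [P eP] := quadratic_polar gq.
have [r [s ex]] := line_span (z0 _ uR).1.1 (z0 _ vR).1.1 uv a0 (z0 _ uR).1.2 (z0 _ vR).1.2 (z0 _ xR).1.2.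
have [r' [s' ey]] := line_span (z0 _ uR).1.1 (z0 _ vR).1.1 uv a0 (z0 _ uR).1.2 (z0 _ vR).1.2 ay.
have r0 : r != 0.
  apply: contraNneq vx => r0; have exv : x = scale s v.
    by rewrite ex r0; apply/ffunP => i; rewrite !ffunE mul0r add0r.
  have := (z0 _ xR).1.1; rewrite exv => /(points_scale (z0 _ vR).1.1) ->.
  by rewrite scale1.
have s0 : s != 0.
  apply: contraNneq xu => s0; have exv : x = scale r u.
    by rewrite ex s0; apply/ffunP => i; rewrite !ffunE mul0r addr0.
  have := (z0 _ xR).1.1; rewrite exv => /(points_scale (z0 _ uR).1.1) ->.
  by rewrite scale1.
have := (z0 _ xR).2; rewrite ex ey !eP !(z0 _ uR).2 !(z0 _ vR).2 !mulr0 !addr0 !add0r.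
move=> /eqP; rewrite !mulf_eq0 (negPf r0) (negPf s0) /= => /eqP ->.
by rewrite mulr0.
Qed.

(* With x off the line a = 0 and r = a(y)/a(x), the point y - r x lies on the
   line; expanding g (y - r x) = 0 exhibits the factor r of g y. *)
Lemma quadratic_factor g a : is_quadratic g -> a != 0 -> (forall y, dot a y = 0 -> g y = 0) ->
  exists b, forall y, g y = dot a y * dot b y.
Proof.
move=> gq /dot_neq0[x ax] g0; have [P eP] := quadratic_polar gq.
exists (P x - scale (g x) a) => y.
have := g0 (scale (- dot a y) x + scale 1 y).
rewrite dotDr !dotZr ax mulr1 mul1r addNr => /(_ erefl).
rewrite eP expr1n !mul1r mulr1 => /eqP; rewrite addrC addr_eq0 => /eqP ->.
have -> : dot (P x - scale (g x) a) y = dot (P x) y - g x * dot a y.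
  by rewrite -dotZl; rewrite !dotE !ffunE; ring.
by ring.
Qed.

(** A vector space is not the union of two proper subspaces, over any field: one of x, y, x + y is
    off both kernels. *)
Lemma dot_mul_neq0 a b : a != 0 -> b != 0 -> exists y, dot a y * dot b y != 0.
Proof.
move=> /dot_neq0[x ax] /dot_neq0[y byy].
have [bx|bx] := eqVneq (dot b x) 0; last by exists x; rewrite ax mul1r.
have [ay|ay] := eqVneq (dot a y) 0; last by exists y; rewrite byy mulr1.
by exists (x + y); rewrite !dotDr ax ay byy bx addr0 add0r mulr1 oner_eq0.
Qed.

Lemma dot_mul_eq0 a b : (forall y, dot a y * dot b y = 0) -> a = 0 \/ b = 0.
Proof.
move=> e; have [->|a0] := eqVneq a 0; [by left | right; apply/eqP].
by apply: contraT => /(dot_mul_neq0 a0)[y]; rewrite e eqxx.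
Qed.

(** The argument of [dot_mul_neq0] inside the plane a = 0: if neither b nor c is a multiple of a,
    both are nonzero somewhere on it, and so is their product. *)
Lemma dot_prime a b c : a != 0 -> (forall y, dot a y = 0 -> dot b y * dot c y = 0) ->
  (exists r, b = scale r a) \/ (exists r, c = scale r a).
Proof.
move=> a0 e.
have [|n0] := eqVneq (cross b a) 0; first by move/(cross_eq0 a0); left.
have [|n1] := eqVneq (cross c a) 0; first by move/(cross_eq0 a0); right.
suff [y ay]: exists2 y, dot a y = 0 & dot b y * dot c y != 0 by rewrite e ?eqxx.
(* The vector [cross a x] is on a, and d takes there the value of the determinant (d, a, x), which
   is [dot (cross d a) x]. *)
have key d : cross d a != 0 -> exists2 x, dot a x = 0 & dot d x = 1.
  move=> /dot_neq0[x ex]; exists (cross a x); first by rewrite dotC dot_crossl.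
  by rewrite -ex !dotE !vec3E; ring.
have [x ax bx] := key _ n0; have [y ay cy] := key _ n1.
have [cx|cx] := eqVneq (dot c x) 0; last by exists x; rewrite // bx mul1r.
have [by0|by0] := eqVneq (dot b y) 0; last by exists y; rewrite // cy mulr1.
by exists (x + y); rewrite !dotDr ?ax ?ay ?addr0 // bx by0 cx cy addr0 add0r mulr1 oner_eq0.
Qed.

End QuadraticForms.

(** * Weights orthogonal to forms of degree k, and the collinearity threshold *)

Section Dependencies.
Variable F : finFieldType.
Local Notation V := {ffun 'I_3 -> F}.
Local Notation weight := {ffun V -> F}.
Implicit Types (a b u v x y : V) (w : weight) (R : {set V}) (k : nat).

Definition mulw (g : V -> F) w : weight := [ffun v => g v * w v].

Definition supp w : {set V} := [set v | w v != 0].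

(* [dep k w]: the weight w is orthogonal to all forms of degree k. *)
Fixpoint dep k w : Prop :=
  if k is k'.+1 then forall a, dep k' (mulw (dot a) w) else \sum_v w v = 0.

Lemma supp_mulw g w : supp (mulw g w) = supp w :\: zeros g.
Proof. by apply/setP => v; rewrite !inE ffunE mulf_eq0 negb_or. Qed.

Lemma suppP w : reflect (w = 0) (supp w == set0).
Proof.
apply: (iffP eqP) => [e | ->]; last by apply/setP => v; rewrite !inE ffunE eqxx.
by apply/ffunP => v; have := in_set0 v; rewrite -e inE ffunE => /negbFE/eqP.
Qed.

Lemma dep_comb k r s w1 w2 : dep k w1 -> dep k w2 -> dep k [ffun v => r * w1 v + s * w2 v].
Proof.
elim: k w1 w2 => [|k IH] w1 w2 /= d1 d2.
  under eq_bigr => v _ do rewrite ffunE.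
  by rewrite big_split /= -!mulr_sumr d1 d2 !mulr0 addr0.
move=> a; have -> : mulw (dot a) [ffun v => r * w1 v + s * w2 v] =
    [ffun v => r * mulw (dot a) w1 v + s * mulw (dot a) w2 v].
  by apply/ffunP => v; rewrite !ffunE; ring.
exact: IH.
Qed.

Lemma dep_quadratic k g w : is_quadratic g -> dep k.+2 w -> dep k (mulw g w).
Proof.
move=> [C eC] dw.
pose t i : weight := mulw (dot [ffun j => (j == i)%:R]) (mulw (dot (C i)) w).
have dt i : dep k (t i) by apply: dw.
have := dep_comb 1 1 (dep_comb 1 1 (dt 0) (dt 1)) (dt 2%:R).
set w' := finfun _; suff -> : mulw g w = w' by [].
apply/ffunP => v; rewrite !ffunE !dotE !ffunE /= eC.
rewrite !big_ord_recl !big_ord0.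
have e0 : ord0 = 0 :> 'I_3 by apply: val_inj.
have e1 : lift ord0 ord0 = 1 :> 'I_3 by apply: val_inj.
have e2 : lift ord0 (lift ord0 ord0) = 2%:R :> 'I_3 by apply: val_inj.
by rewrite !dotE !e2 !e1 !e0; ring.
Qed.

Lemma separating_line x y : x \in points F -> y \in points F -> x != y ->
  exists a, dot a x = 0 /\ dot a y = 1.
Proof.
move=> xP yP xy; have [|e ee] := @dot_neq0 _ (cross y x).
  by rewrite points_cross_neq0 // eq_sym.
exists (cross x e); split; first exact: dot_crossl.
by rewrite -ee !dotE !vec3E; ring.
Qed.

(** Any k + 1 points impose independent conditions on forms of degree k: a line through one support
    point and off another removes the first, keeps the second, and lowers the degree by one. *)
Lemma dep_card k w : supp w \subset points F -> dep k w -> w != 0 -> (k.+2 <= #|supp w|)%N.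
Proof.
elim: k w => [|k IH] w /subsetP wP dw w0.
  have [x xw] : exists x, x \in supp w.
    by apply/set0Pn; apply: contraNneq w0 => /eqP/suppP ->.
  rewrite (cardsD1 x) xw ltnS card_gt0; apply: contraTneq isT => e.
  move: dw; rewrite /= (bigD1 x) //= big1 ?addr0 => [/eqP|y yx].
    by move: xw; rewrite inE => /negPf ->.
  by have := in_set0 y; rewrite -e !inE yx => /negbFE/eqP.
have [x xw] : exists x, x \in supp w.
  by apply/set0Pn; apply: contraNneq w0 => /eqP/suppP ->.
have [a [ax lt]] : exists a, dot a x != 0 /\ 
    ((supp (mulw (dot a) w) \proper supp w) || (#|supp w| == 1)%N).
  have [|/set0Pn[y]] := eqVneq (supp w :\ x) set0.
    move=> e; have [a ax] := dot_neq0 (points_neq0 (wP x xw)).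
    exists a; rewrite dotC ax oner_eq0; split=> //.
    by rewrite (cardsD1 x) e xw cards0 orbT.
  rewrite in_setD1 => /andP[yx yw].
  have [a [ay ax]] := separating_line (wP _ yw) (wP _ xw) yx.
  exists a; rewrite ax oner_eq0; split=> //.
  apply/orP; left; rewrite supp_mulw properE subsetDl /=.
  by apply/subsetPn; exists y; rewrite // in_setD inE ay eqxx.
have := IH (mulw (dot a) w).
have sub : supp (mulw (dot a) w) \subset supp w by rewrite supp_mulw subsetDl.
have -> : supp (mulw (dot a) w) \subset points F.
  by apply: subset_trans sub _; apply/subsetP.
move=> /(_ isT (dw a)); have -> : mulw (dot a) w != 0.
  apply: contraTneq (isT) => /ffunP/(_ x); rewrite !ffunE => /eqP.
  by rewrite mulf_eq0 (negPf ax); move: xw; rewrite inE => /negPf ->.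
move=> /(_ isT) le; case/orP: lt => [/proper_card | /eqP e1]; first exact: leq_ltn_trans.
by have := subset_leq_card sub; rewrite e1 => /(leq_trans le).
Qed.

Lemma dep_small k w : supp w \subset points F -> dep k w -> (#|supp w| <= k.+1)%N -> w = 0.
Proof.
by move=> wP dw; rewrite leqNgt; apply: contraNeq => /(dep_card wP dw).
Qed.

Lemma collinear_small R : R \subset points F -> (#|R| <= 2)%N ->
  exists2 a, a \in points F & R \subset zeros (dot a).
Proof.
move=> /subsetP RP R2.
have [->|/set0Pn[x xR]] := eqVneq R set0.
  exists (vec3 1 0 0); rewrite ?sub0set // inE vec3E eqxx //.
have [y yR ey] : exists2 y, y \in R & R \subset [set x; y].
  have [e|/set0Pn[y]] := eqVneq (R :\ x) set0.
    by exists x; rewrite // -setD_eq0 setUid e.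
  rewrite in_setD1 => /andP[yx yR]; exists y => //.
  apply/subsetP => z zR; apply: contraTT R2; rewrite -ltnNge !inE negb_or => /andP[zx zy].
  by apply/card_gt2P; exists x, y, z; split; split; rewrite // eq_sym.
have [a aP [ax ay]] := line_through_exists (RP _ xR) (RP _ yR).
exists a => //; apply: subset_trans ey _.
by apply/subsetP => z; rewrite !inE => /orP[] /eqP ->; rewrite ?ax ?ay.
Qed.

(** Delete a line a through two support points. By induction the rest lies on a line b and, if
    nonempty, has at least k + 1 points by [dep_card]. So at most k support points are off b, too
    few for a nonzero weight of degree k - 1. *)
Lemma dep_collinear k w : supp w \subset points F -> dep k w ->
  (#|supp w| <= k.*2.+1)%N -> exists2 a, a \in points F & supp w \subset zeros (dot a).
Proof.
elim: k w => [|k IH] w wP dw wn.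
  by apply: collinear_small => //; apply: leq_trans wn _.
have [w2|] := leqP #|supp w| 2; first exact: collinear_small.
move=> /card_gt2P[x [y [_ [[xw yw _] [xy _ _]]]]].
move/subsetP: (wP) => wP'.
have [a aP [ax ay]] := line_through_exists (wP' x xw) (wP' y yw).
have sP b : supp (mulw (dot b) w) \subset points F.
  by rewrite supp_mulw; apply: subset_trans wP; apply: subsetDl.
have le : (#|supp (mulw (dot a) w)| <= k.*2.+1)%N.
  rewrite supp_mulw cardsD; have : [set x; y] \subset supp w :&: zeros (dot a).
    by apply/subsetP => z; rewrite !inE => /orP[] /eqP ->; rewrite ?ax ?ay ?eqxx andbT; [move: xw | move: yw]; rewrite inE.
  by move=> /subset_leq_card; rewrite cards2 xy; move: wn; lia.
have [b bP sb] := IH _ (sP a) (dw a) le.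
have [e|n0] := eqVneq (mulw (dot a) w) 0.
  by exists a => //; rewrite -setD_eq0 -supp_mulw; apply/suppP.
have lo := dep_card (sP a) (dw a) n0.
exists b => //; rewrite -setD_eq0 -supp_mulw; apply/suppP.
apply: dep_small (sP b) (dw b) _.
have : supp (mulw (dot a) w) \subset supp w :&: zeros (dot b).
  by rewrite subsetI sb andbT supp_mulw subsetDl.
move=> /subset_leq_card; rewrite supp_mulw in lo *; rewrite supp_mulw (cardsD _ (zeros (dot b))).
by move: lo wn; lia.
Qed.

End Dependencies.

Ltac lia_nat := repeat match goal with
  | H : is_true (leq _ _) |- _ => revert H
  | H : @eq nat _ _ |- _ => revert H
  end;
  repeat match goal with H : ?T |- _ => match type of T with Prop => clear H end end;
  lia.

Lemma subset_of_card (T : finType) (A B : {set T}) n : A \subset B ->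
  (#|A| <= n <= #|B|)%N -> exists C : {set T}, [/\ A \subset C, C \subset B & #|C| = n].
Proof.
move=> sAB /andP[]; elim: n => [|n IH] leA leB.
  by exists A; split=> //; apply/eqP; rewrite -leqn0.
have [e|n0] := eqVneq #|A| n.+1; first by exists A.
have [||C [sA sB cC]] := IH; first by rewrite -ltnS ltn_neqAle n0.
  exact: ltnW.
have [x xB xC] : exists2 x, x \in B & x \notin C.
  by apply/subsetPn; apply: contraL leB => /subset_leq_card; rewrite cC -leqNgt.
exists (x |: C); split; first exact: subset_trans sA (subsetUr _ _).
  by rewrite subUset sub1set xB.
by rewrite cardsU1 xC cC.
Qed.

Lemma linear_system (F : fieldType) (J T : finType) (E : {set T}) (g : T -> J -> F) :
  (#|E| < #|J|)%N ->
  exists2 c : {ffun J -> F}, exists j, c j != 0 & forall t, t \in E -> \sum_j c j * g t j = 0.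
Proof.
move=> EJ; pose M := \matrix_(i < #|J|, j < #|E|) g (enum_val j) (enum_val i).
have : kermx M != 0.
  rewrite -mxrank_eq0 mxrank_ker -lt0n subn_gt0.
  exact: leq_ltn_trans (rank_leq_col _) EJ.
case/rowV0Pn => v /sub_kermxP vM v0.
exists [ffun j => v 0 (enum_rank j)].
  apply/existsP; apply: contraNT v0; rewrite negb_exists => /forallP h.
  by apply/eqP/rowP => i; have := h (enum_val i); rewrite negbK ffunE enum_valK mxE => /eqP.
move=> t tE; have := congr1 (fun N : 'rV__ => N 0 (enum_rank_in tE t)) vM.
rewrite !mxE (reindex (@enum_rank J)) /=; last exact: onW_bij (@enum_rank_bij J).
by move=> e; rewrite -[RHS]e; apply: eq_bigr => j _; rewrite ffunE mxE enum_rankK enum_rankK_in.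
Qed.

(** * Sets in general position carry no dependency below 3k points *)

Section GeneralPosition.
Variable F : finFieldType.
Local Notation V := {ffun 'I_3 -> F}.
Local Notation weight := {ffun V -> F}.
Implicit Types (a b u v x y : V) (w : weight) (R : {set V}) (k : nat).

(** Six unknown coefficients against at most four linear conditions leave a solution space of
    dimension at least two. *)
Lemma linear_pencil (s t : V -> F) (E : {set V}) : (#|E| <= 4)%N ->
  exists l m l' m' : V,
    [/\ l != 0 \/ m != 0,
        forall r, ~ (l' = scale r l /\ m' = scale r m),
        forall v, v \in E -> dot l v * s v + dot m v * t v = 0 &
        forall v, v \in E -> dot l' v * s v + dot m' v * t v = 0].
Proof.
move=> E4; pose J : finType := ('I_3 + 'I_3)%type.
have cJ : #|{: J}| = 6 by rewrite card_sum !card_ord.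
pose g (o : option V) (j0 j : J) : F := match o, j with
  | None, _ => (j == j0)%:R | Some v, inl i => v i * s v | Some v, inr i => v i * t v end.
pose fl (c : {ffun J -> F}) : V := [ffun i => c (inl i)].
pose fm (c : {ffun J -> F}) : V := [ffun i => c (inr i)].
have sumE (c : {ffun J -> F}) v j0 : \sum_j c j * g (Some v) j0 j = dot (fl c) v * s v + dot (fm c) v * t v.
  by rewrite big_sumType /= /dot !mulr_suml; congr (_ + _); apply: eq_bigr => i _; rewrite ffunE mulrA.
have cE : #|[set Some v | v in E]| = #|E| by apply: card_imset => x y [].
have [|c [j0 cj0] cP] := @linear_system F J _ [set Some v | v in E] (g^~ (inl 0)).
  by rewrite cE cJ ltnS; apply: leq_trans E4 _.
(* The equation indexed by [None] makes coordinate [j0] of the second solution vanish; as [c j0] is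
   nonzero, the second solution is not a multiple of the first. *)
have [|c' [j1 cj1] cP'] := @linear_system F J _ (None |: [set Some v | v in E]) (g^~ j0).
  by rewrite cardsU1 cE cJ; apply: leq_ltn_trans (leq_add (leq_b1 _) E4) _.
have c'0 : c' j0 = 0.
  have := cP' None (setU11 _ _); rewrite (bigD1 j0) //= eqxx mulr1 big1 ?addr0 // => j /negPf ->.
  by rewrite mulr0.
exists (fl c), (fm c), (fl c'), (fm c'); split.
- move: cj0; case: j0 {c'0 cP'} => i ci; [left|right]; apply: contraNneq ci => /ffunP/(_ i);
  by rewrite !ffunE => ->.
- move=> r [/ffunP e1 /ffunP e2].
  have e j : c' j = r * c j.
    by case: j => i; [have := e1 i | have := e2 i]; rewrite !ffunE.
  have r0 : r = 0 by move: c'0; rewrite e => /eqP; rewrite mulf_eq0 (negPf cj0) orbF => /eqP.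
  by move: cj1; rewrite e r0 mul0r eqxx.
- by move=> v vE; rewrite -(sumE _ _ (inl 0)); apply: cP; rewrite imset_f.
- by move=> v vE; rewrite -(sumE _ _ j0); apply: cP'; rewrite in_setU imset_f ?orbT.
Qed.

(** Makes the existence of a dependency inside a given set a boolean, so that proofs can branch on
    it. *)
Lemma dep_dec k w : decidable (dep k w).
Proof.
elim: k w => [|k IH] w /=; first exact: decP eqP.
have [h|h] := boolP [forall a, is_left (IH (mulw (dot a) w))].
  by left=> a; move/forallP/(_ a): h; case: (IH _).
by right => d; case/negP: h; apply/forallP => a; case: (IH _) => // /(_ (d a)).
Qed.

(** The residual configuration of [dep_conic]: no line with three points and no conic with six can
    be deleted. *)
Definition general_position R :=
  [/\ R \subset points F,
      forall a, a != 0 -> (#|R :&: zeros (dot a)| <= 2)%N &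
      forall g, is_quadratic g -> (exists y, g y != 0) -> (#|R :&: zeros g| <= 5)%N].

Lemma general_position_sub R R' : R' \subset R -> general_position R -> general_position R'.
Proof.
move=> sR [RP R2 R5]; split; first exact: subset_trans RP.
  by move=> a /R2; apply: leq_trans; rewrite subset_leq_card // setSI.
by move=> g gq /(R5 _ gq); apply: leq_trans; rewrite subset_leq_card // setSI.
Qed.

Lemma dep_iter k m a w : dep (m + k) w -> dep k (iter m (mulw (dot a)) w).
Proof. by elim: m w => // m IH w dw; rewrite iterSr; apply: IH; apply: dw. Qed.

Lemma supp_iter m a w : (0 < m)%N -> supp (iter m (mulw (dot a)) w) = supp w :\: zeros (dot a).
Proof.
case: m => // m _; elim: m => [|m IH]; first exact: supp_mulw.
by rewrite iterS supp_mulw IH setDDl setUid.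
Qed.

Lemma mulw_eq0 g w : (mulw g w == 0) = (supp w \subset zeros g).
Proof. by rewrite -setD_eq0 -supp_mulw; apply/eqP/suppP. Qed.

(* Two dependencies lam, mu of degree a with distinct supports in a set of
   3a + 1 points admit a pencil of syzygies l lam + m mu = 0 with linear l, m,
   because dependencies of degree a - 1 on these points form a space of
   dimension at most 4; two such syzygies give a conic through all points. *)
Lemma dep_step R (I W : {set V}) k x y (lam mu : weight) :
  general_position R -> W \subset R -> I \subset W -> (#|W :\: I| <= 4)%N ->
  (forall nu, supp nu \subset I -> dep k nu -> nu = 0) ->
  (5 < #|W|)%N -> x \in W -> y \in W -> x != y ->
  dep k.+1 lam -> dep k.+1 mu -> supp lam = W :\ x -> supp mu = W :\ y -> False.
Proof.
move=> [RP R2 R5] WR IW WI indI W5 xW yW xy dl dm sl sm.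
have supp_line a nu : a != 0 -> supp nu \subset W -> supp nu \subset zeros (dot a) ->
    (#|supp nu| <= 2)%N.
  move=> a0 sW sa; apply: leq_trans (R2 a a0); apply: subset_leq_card.
  by rewrite subsetI sa (subset_trans sW WR).
have [l [m [l' [m' [lm0 indep E1 E2]]]]] := linear_pencil lam mu WI.
have vanish p q (E : forall v, v \in W :\: I -> dot p v * lam v + dot q v * mu v = 0) :
    forall v, dot p v * lam v + dot q v * mu v = 0.
  pose nu : weight := [ffun v => 1 * mulw (dot p) lam v + 1 * mulw (dot q) mu v].
  suff /ffunP nu0 : nu = 0 by move=> v; have := nu0 v; rewrite !ffunE !mul1r.
  apply: indI; last exact: dep_comb (dl p) (dm q).
  apply/subsetP => v; rewrite inE !ffunE !mul1r; apply: contraR => vI.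
  have [vW|vW] := boolP (v \in W); first by rewrite E // in_setD vI.
  have : v \notin supp lam by rewrite sl !inE (negPf vW) andbF.
  have : v \notin supp mu by rewrite sm !inE (negPf vW) andbF.
  by rewrite !inE !negbK => /eqP -> /eqP ->; rewrite !mulr0 addr0.
have V1 := vanish _ _ E1; have V2 := vanish _ _ E2.
have slW : supp lam \subset W by rewrite sl subsetDl.
have smW : supp mu \subset W by rewrite sm subsetDl.
have cm : (3 < #|supp mu|)%N by move: W5; rewrite sm (cardsD1 y W) yW add1n ltnS; apply: leq_trans.
have g0 v : dot m v * dot l' v - dot m' v * dot l v = 0.
  apply/eqP; apply: contraT => gv.
  have gq := quadratic_sub (quadratic_mul m l') (quadratic_mul m' l).
  have := R5 _ gq (ex_intro _ v gv).
  rewrite leqNgt (leq_trans W5) // subset_leq_card // subsetI WR /=.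
  apply/subsetP => z zW; rewrite inE.
  have [lz|lz] := eqVneq (lam z) 0.
    have mz : mu z != 0.
      have : (z \in supp lam) || (z \in supp mu).
        by rewrite sl sm !inE zW !andbT -negb_and; apply: contra xy => /andP[/eqP <- /eqP <-].
      by rewrite !inE lz eqxx.
    rewrite -(inj_eq (mulfI mz)) mulr0.
    have e1 := V1 z; have e2 := V2 z; rewrite lz !mulr0 !add0r in e1 e2.
    by rewrite mulrBr !mulrA [mu z * _]mulrC e1 [mu z * _]mulrC e2 !mul0r subrr.
  rewrite -(inj_eq (mulfI lz)) mulr0; have e1 := V1 z; have e2 := V2 z.
  have -> : lam z * (dot m z * dot l' z - dot m' z * dot l z) =
    dot m z * (dot l' z * lam z + dot m' z * mu z)
    - dot m' z * (dot l z * lam z + dot m z * mu z) by ring.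
  by rewrite e1 e2 !mulr0 subrr.
have l0 : l != 0.
  apply: contraTneq cm => l0; have m0 : m != 0 by case: lm0 => //; rewrite l0 eqxx.
  rewrite -leqNgt; apply: leq_trans (supp_line _ _ m0 smW _) _ => //.
  apply/subsetP => v; rewrite !inE => mv; have := V1 v; rewrite l0 dot0l mul0r add0r => /eqP.
  by rewrite mulf_eq0 (negPf mv) orbF.
(* From m l' = m' l, the prime l divides m or l'. If m = r l, then lam + r mu is supported on the
   line l, where R has at most two points; so it is zero, although y is in the support of lam only.
   If l' = r l, then m' = r m, against independence. *)
have [[r er] | [r er]] : (exists r, m = scale r l) \/ (exists r, l' = scale r l).
    apply: dot_prime l0 _ => v lv; have := g0 v; rewrite lv mulr0 subr0; exact.
  pose nu : weight := [ffun v => 1 * lam v + r * mu v].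
  have dnu : dep k.+1 nu by apply: dep_comb.
  have sW : supp nu \subset W.
    apply/subsetP => v; rewrite inE ffunE; apply: contraR => vW.
    have : v \notin supp lam by apply: contra vW; apply: subsetP.
    have : v \notin supp mu by apply: contra vW; apply: subsetP.
    by rewrite !inE !negbK => /eqP -> /eqP ->; rewrite !mulr0 addr0.
  have nu0 : nu = 0.
    apply: (dep_small _ dnu); first exact: subset_trans sW (subset_trans WR RP).
    apply: leq_trans (supp_line _ _ l0 sW _) _; rewrite ?ltnS //.
    apply/subsetP => v; rewrite !inE ffunE mul1r => nv; have := V1 v.
    rewrite er dotZl => /eqP; rewrite (_ : _ + _ = dot l v * (lam v + r * mu v)); last by ring.
    by rewrite mulf_eq0 (negPf nv) orbF.
  have : y \in supp lam by rewrite sl !inE yW eq_sym xy.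
  have : y \notin supp mu by rewrite sm !inE eqxx.
  move/ffunP/(_ y): nu0; rewrite !inE !ffunE mul1r negbK => e /eqP my.
  by move: e; rewrite my mulr0 addr0 => ->; rewrite eqxx.
apply: (indep r); split=> //.
have [|/eqP|e] := @dot_mul_eq0 _ l (scale r m - m').
- move=> v; rewrite -[RHS](g0 v) er dotZl.
  have -> : dot (scale r m - m') v = r * dot m v - dot m' v.
    by rewrite -dotZl !dotE !ffunE; ring.
  by ring.
- by rewrite (negPf l0).
- by apply/esym/eqP; rewrite -subr_eq0 e.
Qed.

(** If w were nonzero, its support would contain sets I of exactly 3j points independent for degree
    j, for each 0 < j < k, built by adding three points at a time. For j = k - 1 at most two support
    points are outside I. Multiplying by a line through them gives a weight of degree k - 1 on I,
    hence zero, so the whole support would be collinear. *)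
Lemma dep_general_position k w : general_position (supp w) -> (#|supp w| < 3 * k)%N ->
  dep k w -> w = 0.
Proof.
elim/ltn_ind: k w => k IH w gp wn dw.
apply/eqP; apply: contraT => w0.
have [RP R2 R5] := gp.
have nk := dep_card RP dw w0.
have IH' j w' : (j < k)%N -> supp w' \subset supp w -> (#|supp w'| < 3 * j)%N ->
    dep j w' -> w' = 0.
  by move=> jk sw; apply: IH => //; apply: general_position_sub gp.
have notline a : a != 0 -> ~~ (supp w \subset zeros (dot a)).
  by move=> /R2 ra; apply: contraTN ra => /setIidPl ->; lia_nat.
have key (a : nat) : (a.+1 < k)%N -> exists I : {set V}, [/\ I \subset supp w, #|I| = (3 * a.+1)%N &
    forall nu, supp nu \subset I -> dep a.+1 nu -> nu = 0].
  elim: a => [|a IHa] ak.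
    have [||I [_ IR cI]] := @subset_of_card _ set0 (supp w) 3; rewrite ?sub0set ?cards0 //; first by lia_nat.
    exists I; split=> // nu nuI dnu.
    have nuP : supp nu \subset points F by apply: subset_trans nuI (subset_trans IR RP).
    have [|b bP nb] := dep_collinear nuP dnu; first by have := subset_leq_card nuI; rewrite cI.
    apply: dep_small nuP dnu _; apply: leq_trans (R2 _ (points_neq0 bP)).
    by rewrite subset_leq_card // subsetI nb (subset_trans nuI IR).
  have [I [IR cI indI]] := IHa (ltnW ak).
  (* Otherwise multiply w repeatedly by a line b through a support point, down to degree a + 2: at
     least one point is lost, so the induction hypothesis gives zero and puts the support on b. *)
  have nbig : (3 * a.+2 < #|supp w|)%N.
    rewrite ltnNge; apply/negP => nsmall.
    have [x xw] : exists x, x \in supp w by apply/set0Pn; apply: contraNneq w0 => /eqP/suppP ->.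
    have [||b bP bx] := @collinear_small _ [set x]; rewrite ?cards1 ?sub1set ?(subsetP RP) //.
    have bx0 : x \in zeros (dot b) by move: bx; rewrite sub1set.
    have sE := supp_iter b w (_ : 0 < k - a.+2)%N; rewrite subn_gt0 in sE.
    have e0 : iter (k - a.+2) (mulw (dot b)) w = 0.
      apply: (IH' a.+2); rewrite ?sE ?subsetDl //.
        apply: leq_trans nsmall; apply: proper_card; rewrite properE subsetDl /=.
        by apply/subsetPn; exists x; rewrite // in_setD bx0.
      by apply: dep_iter; rewrite subnK // ltnW.
    case/negP: (notline _ (points_neq0 bP)).
    by rewrite -setD_eq0 -sE // e0; apply/suppP.
  have [|W [IW WR cW]] := subset_of_card (n := (3 * a.+2).+1) IR; first by rewrite cI nbig andbT; lia_nat.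
  have /card_gt1P[x [y [xW yW xy]]] : (1 < #|W|)%N by rewrite cW.
  (* If W minus x or W minus y is independent, it serves as the next I. Otherwise each carries a
     nonzero weight, whose support is all of it by the induction hypothesis, and [dep_step]
     applies. *)
  pose bad (A : {set V}) := [exists nu : weight, [&& nu != 0, supp nu \subset A & is_left (dep_dec a.+2 nu)]].
  have good z : z \in W -> ~~ bad (W :\ z) -> exists I : {set V},
      [/\ I \subset supp w, #|I| = (3 * a.+2)%N & forall nu, supp nu \subset I -> dep a.+2 nu -> nu = 0].
    move=> zW /existsPn h; exists (W :\ z); split.
    - exact: subset_trans (subsetDl _ _) WR.
    - by have := cardsD1 z W; rewrite zW cW; lia_nat.
    move=> nu snu dnu; have := h nu; rewrite snu /=; case: (dep_dec _ _) => // d.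
    by rewrite andbT negbK => /eqP.
  have [/existsP[lam /and3P[lam0 sl]]|] := boolP (bad (W :\ x)); last exact: good.
  case: (dep_dec _ lam) => // dl _.
  have [/existsP[mu /and3P[mu0 sm]]|] := boolP (bad (W :\ y)); last exact: good.
  case: (dep_dec _ mu) => // dm _.
  have full z nu : z \in W -> nu != 0 -> supp nu \subset W :\ z -> dep a.+2 nu -> supp nu = W :\ z.
    move=> zW nu0 snu dnu; apply/eqP; rewrite eqEcard snu /= leqNgt.
    apply: contraNN nu0 => small; apply/eqP; apply: (IH' a.+2) => //.
      exact: subset_trans snu (subset_trans (subsetDl _ _) WR).
    by move: small; have /eqP := cardsD1 z W; rewrite zW cW add1n eqSS => /eqP <-.
  exfalso; apply: (@dep_step (supp w) I W a.+1 x y lam mu gp WR IW _ indI) => //.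
  - by rewrite cardsD (setIidPr IW) cW cI; lia_nat.
  - by rewrite cW; lia_nat.
  - exact: full.
  - exact: full.
have k2 : (1 < k)%N by lia_nat.
have [|I [IR cI indI]] := key k.-2; first by lia_nat.
have [||b bP bR] := @collinear_small _ (supp w :\: I).
- exact: subset_trans (subsetDl _ _) RP.
- by rewrite cardsD (setIidPr IR) cI; lia_nat.
case/negP: (notline _ (points_neq0 bP)).
rewrite -mulw_eq0; apply/eqP; apply: indI.
  by rewrite supp_mulw subDset setUC -subDset.
have := dw; rewrite -(_ : k.-2.+2 = k) /= ; [exact | by lia].
Qed.

End GeneralPosition.

(** * The conic threshold *)

Section Conics.
Variable F : finFieldType.
Local Notation V := {ffun 'I_3 -> F}.
Local Notation weight := {ffun V -> F}.
Implicit Types (a b u v x y : V) (w : weight) (R : {set V}) (k : nat).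

Definition on_conic R :=
  exists g, [/\ is_quadratic g, exists y, g y != 0 & R \subset zeros g].

Lemma zeros_mul (g h : V -> F) : zeros (fun v => g v * h v) = zeros g :|: zeros h.
Proof. by apply/setP => v; rewrite !inE mulf_eq0. Qed.

Lemma lines_on_conic R a b : a != 0 -> b != 0 ->
  R \subset zeros (dot a) :|: zeros (dot b) -> on_conic R.
Proof.
move=> a0 b0; exists (fun v => dot a v * dot b v); split; last by rewrite zeros_mul.
  exact: quadratic_mul.
exact: dot_mul_neq0.
Qed.

Lemma supp0 : supp (0 : weight) = set0.
Proof. by apply/eqP; apply/suppP. Qed.

(** Delete a line with three support points or, failing that, a conic with six; by induction the
    rest lies on a conic g. Comparing the numbers of points missed shows that one conic contains
    everything. With nothing to delete, the support is in general position and w = 0. *)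
Lemma dep_conic k w : supp w \subset points F -> dep k w -> (#|supp w| < 3 * k)%N ->
  on_conic (supp w).
Proof.
elim/ltn_ind: k w => k IH w wP dw wn.
have [/existsP[a /andP[a0 wa]]|] :=
  boolP [exists a : V, (a != 0) && (2 < #|supp w :&: zeros (dot a)|)%N].
  have cw := cardsID (zeros (dot a)) (supp w).
  have dwa : dep k.-1 (mulw (dot a) w).
    by case: k dw wn {IH} => [|k] //= dw _; apply: dw.
  have sP g : supp (mulw g w) \subset points F.
    by rewrite supp_mulw (subset_trans (subsetDl _ _) wP).
  have [||g [gq gy wg]] := IH k.-1 _ (mulw (dot a) w) (sP _) dwa.
  - by lia_nat.
  - by rewrite supp_mulw; lia_nat.
  rewrite supp_mulw in wg.
  have [small|big] := leqP #|supp w :\: zeros (dot a)| (k.-1).*2.+1.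
    have [|b bP] := dep_collinear (sP _) dwa; first by rewrite supp_mulw.
    rewrite supp_mulw subDset => wb.
    exact: lines_on_conic a0 (points_neq0 bP) wb.
  have k2 : (1 < k)%N by lia_nat.
  (* At least 2k support points are off a, hence on g; at most k - 1 are off g, too few for degree k
     - 2. *)
  exists g; split=> //; rewrite -mulw_eq0; apply/eqP; apply: (@dep_small _ k.-2).
  - exact: sP.
  - by apply: dep_quadratic => //; rewrite (_ : k.-2.+2 = k)//; lia_nat.
  have : supp (mulw g w) \subset supp w :&: zeros (dot a).
    rewrite supp_mulw; apply/subsetP => v; rewrite !inE => /andP[gv wv]; rewrite wv /=.
    by apply: contraR gv => av; move/subsetP/(_ v): wg; rewrite !inE av wv; apply.
  by move=> /subset_leq_card; lia_nat.
move=> /existsPn arc.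
have arc2 (R : {set V}) a : R \subset supp w -> a != 0 -> R \subset zeros (dot a) -> (#|R| <= 2)%N.
  move=> Rw a0 Ra; have := arc a; rewrite a0 -leqNgt; apply: leq_trans.
  by rewrite subset_leq_card // subsetI Rw.
have big (g : V -> F) j : dep j (mulw g w) -> (2 < #|supp (mulw g w)|)%N ->
    (j.*2.+1 < #|supp (mulw g w)|)%N.
  move=> dj j2; have sw : supp (mulw g w) \subset supp w by rewrite supp_mulw subsetDl.
  have sP := subset_trans sw wP; rewrite ltnNge; apply/negP => small.
  have [b bP sb] := dep_collinear sP dj small.
  by have := arc2 _ _ sw (points_neq0 bP) sb; rewrite leqNgt j2.
(* A finite parametrization of conics, which turns the existence of one with six support points into
   a boolean. *)
pose Q (C : {ffun 'I_3 -> V}) v := \sum_i v i * dot (C i) v.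
have Qq C : is_quadratic (Q C) by exists C.
have [/existsP[C /andP[/existsP[y Cy] C5]]|] :=
  boolP [exists C : {ffun 'I_3 -> V}, [exists y, Q C y != 0] && (5 < #|supp w :&: zeros (Q C)|)%N].
  have cw := cardsID (zeros (Q C)) (supp w).
  have k2 : (2 < k)%N by lia_nat.
  have dq g : is_quadratic g -> dep k.-2 (mulw g w).
    by move=> gq; apply: dep_quadratic => //; rewrite (_ : k.-2.+2 = k)//; lia_nat.
  have sP g : supp (mulw g w) \subset points F.
    by rewrite supp_mulw (subset_trans (subsetDl _ _) wP).
  have [||g [gq gy wg]] := IH k.-2 _ (mulw (Q C) w) (sP _) (dq _ (Qq C)).
  - by lia_nat.
  - by rewrite supp_mulw; lia_nat.
  have [e|n0] := eqVneq (mulw (Q C) w) 0.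
    by exists (Q C); split=> //; [exists y | rewrite -mulw_eq0 e].
  (* No three support points are collinear here, so a nonzero weight of degree k - 2 has at least 2k
     - 2 points. The points off [Q C] and those off g would be disjoint, 4k - 4 in all, against
     fewer than 3k (k >= 5 because of the six points on [Q C]). *)
  have large (h : V -> F) : is_quadratic h -> mulw h w != 0 ->
      (k.-2.*2.+1 < #|supp w :\: zeros h|)%N.
    move=> hq h0; rewrite -supp_mulw; apply: big (dq _ hq) _.
    by apply: leq_trans (dep_card (sP _) (dq _ hq) h0); lia_nat.
  have m1 := large _ (Qq C) n0.
  exists g; split=> //; rewrite -mulw_eq0; apply: contraT => /(large _ gq).
  have := cardsID (zeros g) (supp w).
  have : supp w :\: zeros (Q C) \subset supp w :&: zeros g.
    by rewrite subsetI subsetDl -supp_mulw.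
  by move=> /subset_leq_card; lia_nat.
move=> /existsPn nocon.
have w0 : w = 0.
  apply: (dep_general_position _ wn dw); split=> //.
    by move=> a a0; have := arc a; rewrite a0 -leqNgt.
  move=> g [C eC] [y gy]; have := nocon (finfun C).
  have eg : Q (finfun C) =1 g by move=> v; rewrite eC; apply: eq_bigr => i _; rewrite ffunE.
  have -> : [exists z, Q (finfun C) z != 0] by apply/existsP; exists y; rewrite eg.
  rewrite -leqNgt; apply: leq_trans; apply: subset_leq_card.
  by apply/subsetP => v; rewrite !inE eg.
have [||a0 aP _] := @collinear_small F set0; rewrite ?sub0set ?cards0 //.
rewrite w0 supp0; apply: (lines_on_conic (points_neq0 aP) (points_neq0 aP)).
exact: sub0set.
Qed.

End Conics.

(** * Incidence counts over all lines *)

Section Counting.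
Variable F : finFieldType.
Local Notation V := {ffun 'I_3 -> F}.
Local Notation weight := {ffun V -> F}.
Local Notation q := #|F|.
Implicit Types (a b u v x y : V) (w : weight) (R : {set V}) (k : nat).

Lemma card_points_eq : #|points F| = (q ^ 2 + q + 1)%N.
Proof.
have key m : (m.+1 ^ 3 - 1 = m * (m.+1 ^ 2 + m.+1 + 1))%N by rewrite !expnS expn0; lia.
have := card_points F; have := finNzRing_gt1 F; case: q => [|[|m]] //= _ /eqP.
by rewrite key eqn_pmul2l // => /eqP.
Qed.

Lemma card_lineE R a : #|R :&: zeros (dot a)| = (\sum_(v in R) (dot a v == 0%R))%N.
Proof.
by rewrite -sum1_card big_mkcond [RHS]big_mkcond; apply: eq_bigr => v _; rewrite !inE; case: (v \in R); case: (dot a v == 0).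
Qed.

Lemma pencil_count R x : R \subset points F -> x \in points F -> x \notin R ->
  (\sum_(a in points F | dot a x == 0%R) #|R :&: zeros (dot a)| = #|R|)%N.
Proof.
move=> /subsetP RP xP xR; under eq_bigr => a _ do rewrite card_lineE.
rewrite exchange_big -sum1_card; apply: eq_bigr => v vR.
have xv : x != v by apply: contraNneq xR => ->.
have [b bP bE] := line_through xP (RP v vR) xv.
rewrite (bigD1 b) /=; last by rewrite bP; have := bE b bP; rewrite eqxx => /andP[].
have := bE b bP; rewrite eqxx => /andP[_ ->]; rewrite big1 // => a /andP[/andP[aP ax] ab].
by have := bE a aP; rewrite ax (negPf ab) /= => ->.
Qed.

(** Each of the q + 1 lines through x counts x, and every other point of R is on exactly one of
    them: (|R| - 1) + (q + 1). *)
Lemma pencil_count_mem R x : R \subset points F -> x \in R ->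
  (\sum_(a in points F | dot a x == 0%R) #|R :&: zeros (dot a)| = #|R| + q)%N.
Proof.
move=> RP xR; have xP := subsetP RP x xR.
have sRP : R :\ x \subset points F := subset_trans (subsetDl _ _) RP.
have := pencil_count sRP xP _; rewrite !inE eqxx => /(_ isT) e.
rewrite (cardsD1 x R) xR -e addnC addnA addn1 -(card_pencil xP) -sum1_card.
rewrite [X in (X + _)%N](eq_bigl (fun a => (a \in points F) && (dot a x == 0))); last first.
  by move=> a; rewrite inE.
rewrite -big_split; apply: eq_bigr => a /andP[_ ax] /=.
rewrite (cardsD1 x (R :&: _)) !inE xR ax; congr (_ + #|pred_of_set _|)%N.
by apply/setP => v; rewrite !inE andbA.
Qed.

Lemma line_count R : R \subset points F ->
  (\sum_(a in points F) #|R :&: zeros (dot a)| = #|R| * q.+1)%N.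
Proof.
move=> /subsetP RP; under eq_bigr => a _ do rewrite card_lineE.
rewrite exchange_big -sum_nat_const; apply: eq_bigr => v vR.
rewrite -(card_pencil (RP v vR)) -sum1dep_card [RHS]big_mkcondr /=.
by apply: eq_bigr => a _; case: (_ == 0).
Qed.

(** Counts ordered pairs of points of R together with a line through both, by summing
    [pencil_count_mem] over the first point. *)
Lemma square_count R : R \subset points F ->
  (\sum_(a in points F) #|R :&: zeros (dot a)| ^ 2 = #|R| * (#|R| + q))%N.
Proof.
move=> RP; rewrite -sum_nat_const.
rewrite [RHS](eq_bigr _ (fun x xR => esym (pencil_count_mem RP xR))).
under [RHS]eq_bigr => x _ do rewrite big_mkcondr /=.
rewrite exchange_big; apply: eq_bigr => a _.
rewrite -big_mkcondr sum_nat_const -mulnn; congr (_ * _)%N.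
by apply: eq_card => v; rewrite !inE.
Qed.

(* The terms are taken in int since the coefficients c and d are typically
   chosen so that the summand factors as (i - r)(i - s). *)
Lemma quadratic_count R (c d : int) : R \subset points F ->
  \sum_(a in points F) ((#|R :&: zeros (dot a)|%:Z) ^+ 2 - c * #|R :&: zeros (dot a)|%:Z + d) =
  #|R|%:Z * (#|R|%:Z + q%:Z) - c * (#|R|%:Z * (q%:Z + 1)) + d * (q%:Z ^+ 2 + q%:Z + 1).
Proof.
move=> RP; rewrite big_split sumrB -mulr_sumr sumr_const card_points_eq /=.
have sumZ (f : V -> nat) : \sum_(a in points F) (f a)%:Z = (\sum_(a in points F) f a)%N%:Z.
  by rewrite (big_morph Posz PoszD (erefl _)).
rewrite (sumZ (fun a => #|R :&: zeros (dot a)|)) line_count // (eq_bigr (fun a => (#|R :&: zeros (dot a)| ^ 2)%N%:Z)).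
  rewrite sumZ square_count // -mulr_natr natz -mulnn !(PoszD, PoszM).
  by move: #|R| #|F| => r n; rewrite -addn1 PoszD expr2; ring.
by move=> a _; rewrite -mulnn PoszM.
Qed.

End Counting.

(** * Covers of the support by lines: four lines reduce to three *)

Section LineCovers.
Variable F : finFieldType.
Local Notation V := {ffun 'I_3 -> F}.
Local Notation weight := {ffun V -> F}.
Local Notation q := #|F|.
Implicit Types (a b c d m u v x y : V) (R S : {set V}) (k : nat) (s : seq V).

Lemma meet a b : a \in points F -> b \in points F -> a != b ->
  exists2 x, x \in points F &
    forall v, v \in points F -> (dot a v == 0) && (dot b v == 0) = (v == x).
Proof.
move=> aP bP ab; have [x xP xE] := line_through aP bP ab.
by exists x => // v vP; rewrite -xE // !(dotC v).
Qed.

Lemma meet_unique a b u v : a \in points F -> b \in points F -> a != b ->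
  u \in points F -> v \in points F ->
  dot a u = 0 -> dot b u = 0 -> dot a v = 0 -> dot b v = 0 -> u = v.
Proof.
move=> aP bP ab uP vP au bu av bv; have [x xP xE] := meet aP bP ab.
have := xE u uP; have := xE v vP; rewrite au bu av bv eqxx.
by move=> /esym/eqP -> /esym/eqP ->.
Qed.

Lemma fresh_line x s : x \in points F -> (size s <= q)%N ->
  exists m, [/\ m \in points F, dot m x = 0 & m \notin s].
Proof.
move=> xP sq; have cp := card_pencil xP.
have /subsetPn[m] : ~~ ([set a in points F | dot a x == 0] \subset [set a in s]).
  apply: contraTN sq => /subset_leq_card; rewrite cp -ltnNge => /leq_trans; apply.
  by rewrite cardsE card_size.
by rewrite in_set [m \in [set a in s]]inE => /andP[mP /eqP mx] ms; exists m.
Qed.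

Definition union_lines s : {set V} := [set v | has (fun a => dot a v == 0) s].

Lemma union_linesS R s t : all (mem t) s -> R \subset union_lines s -> R \subset union_lines t.
Proof.
move=> /allP st /subset_trans; apply; apply/subsetP => v; rewrite !inE => /hasP[a /st ? av].
by apply/hasP; exists a.
Qed.

(** Some line through x has three points of R, since two on each of the q + 1 lines would give |R|
    <= q + 2. That line is then a component of the conic. *)
Lemma split_conic R : R \subset points F -> on_conic R -> (q + 3 <= #|R|)%N ->
  exists a b, [/\ a \in points F, b \in points F & R \subset union_lines [:: a; b]].
Proof.
move=> RP [g [gq [y gy] Rg]] big.
have /card_gt0P[x xR] : (0 < #|R|)%N by lia_nat.
have [a aP [ax aR]] : exists2 a, a \in points F & dot a x = 0 /\ (2 < #|R :&: zeros (dot a)|)%N.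
  have := pencil_count_mem RP xR.
  have [/existsP[a /and3P[aP /eqP ax aR]]|/existsPn h] :=
    boolP [exists a, [&& a \in points F, dot a x == 0 & (2 < #|R :&: zeros (dot a)|)%N]].
    by exists a.
  have le : (\sum_(a in points F | dot a x == 0%R) #|R :&: zeros (dot a)| <=
      \sum_(a in points F | dot a x == 0%R) 2)%N.
    apply: leq_sum => a /andP[aP ax]; have := h a.
    by rewrite aP ax /= -leqNgt.
  move: le; rewrite sum_nat_const (_ : #|_| = q.+1); last first.
    by rewrite -(card_pencil (subsetP RP x xR)) cardsE.
  by move=> le e; exfalso; move: le; rewrite e; lia_nat.
have [b gE] : exists b, forall v, g v = dot a v * dot b v.
  apply: (quadratic_factor gq (points_neq0 aP)).
  apply: (quadratic_line gq (points_neq0 aP) _ aR); last exact: subset_trans (subsetIl _ _) Rg.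
    exact: subset_trans (subsetIl _ _) RP.
  exact: subsetIr.
have b0 : b != 0 by apply: contraNneq gy => b0; rewrite gE b0 dot0l mulr0.
have [r [b' [r0 bP eb]]] := normalize b0.
exists a, b'; split=> //; apply: subset_trans Rg _; apply/subsetP => v.
by rewrite !inE /= gE eb dotZl !mulf_eq0 (negPf r0) orbF.
Qed.

Variable w : weight.
Hypothesis q4 : (4 < q)%N.
Hypothesis wP : supp w \subset points F.
Hypothesis dw : dep q.-1 w.
Hypothesis w3 : #|supp w| = (3 * q)%N.
Hypothesis w2 : forall a, a \in points F -> (1 < #|supp w :&: zeros (dot a)|)%N.

Definition outside s := #|supp w :\: union_lines s|.

Definition delete s : weight := foldr (fun a => mulw (dot a)) w s.

Lemma supp_delete s : supp (delete s) = supp w :\: union_lines s.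
Proof.
elim: s => [|a s IH] /=; first by apply/setP => v; rewrite !inE.
by rewrite supp_mulw IH; apply/setP => v; rewrite !inE /= negb_or andbA.
Qed.

Lemma supp_deleteP s : supp (delete s) \subset points F.
Proof. by rewrite supp_delete; apply: subset_trans wP; apply: subsetDl. Qed.

Lemma dep_delete s k : (size s + k = q.-1)%N -> dep k (delete s).
Proof.
have h s' k' (v : weight) : dep (size s' + k') v -> dep k' (foldr (fun a => mulw (dot a)) v s').
  by elim: s' k' => [|a s' IH] k' d //=; apply: (IH k'.+1); rewrite addnS.
by move=> e; apply: h; rewrite e.
Qed.

Lemma cover_line s : (size s <= q.-1)%N -> 
  (outside s <= (q.-1 - size s).*2.+1)%N ->
  exists2 a, a \in points F & supp w \subset union_lines (a :: s).
Proof.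
move=> sq small; have d := dep_delete (subnKC sq).
have [|a aP sa] := dep_collinear (supp_deleteP s) d; first by rewrite supp_delete.
exists a => //; move: sa; rewrite supp_delete subDset => h; apply: subset_trans h _.
by apply/subsetP => v; rewrite !inE orbC.
Qed.

Lemma cover_conic s : (size s <= q.-1)%N -> 
  (outside s < 3 * (q.-1 - size s))%N ->
  (q + 3 <= outside s)%N ->
  exists a b, [/\ a \in points F, b \in points F & supp w \subset union_lines [:: a, b & s]].
Proof.
move=> sq; rewrite /outside -supp_delete => small big; have d := dep_delete (subnKC sq).
have [a [b [aP bP]]] := split_conic (supp_deleteP s) (dep_conic (supp_deleteP s) d small) big.
rewrite supp_delete subDset => h; exists a, b; split=> //; apply: subset_trans h _.
by apply/subsetP => v; rewrite !inE /= orbF orbC orbA.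
Qed.

(** The weight left after deleting the lines of s is nonzero of degree q - 1 - |s|; [dep_card] adds
    two. *)
Lemma card_exclusive s : (size s <= q.-1)%N -> ~~ (supp w \subset union_lines s) ->
  (q.+1 <= outside s + size s)%N.
Proof.
move=> sq nc; have n0 : delete s != 0.
  by apply: contraNneq nc => e; rewrite -setD_eq0 -supp_delete e; apply/suppP.
have := dep_card (supp_deleteP s) (dep_delete (subnKC sq)) n0.
by rewrite supp_delete -/(outside s); lia_nat.
Qed.

(** The tool for proving that a point is in the support: m has two support points, and S leaves no
    other places for them. *)
Lemma two_points m S : m \in points F -> supp w :&: zeros (dot m) \subset S -> (#|S| <= 2)%N ->
  S \subset supp w.
Proof.
move=> mP sS S2; suff <- : supp w :&: zeros (dot m) = S by apply: subsetIl.
by apply/eqP; rewrite eqEcard sS (leq_trans S2) // w2.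
Qed.

(** [outside] of three of the lines counts the support points on the fourth alone. These four sets
    and M are pairwise disjoint. *)
Lemma card_exclusive_sum a b c d (M : {set V}) :
  supp w \subset union_lines [:: a; b; c; d] -> M \subset supp w ->
  (forall v, v \in M ->
    1 < (dot a v == 0%R) + (dot b v == 0%R) + (dot c v == 0%R) + (dot d v == 0%R))%N ->
  (outside [:: b; c; d] + outside [:: a; c; d] +
   outside [:: a; b; d] + outside [:: a; b; c] + #|M|
   <= 3 * q)%N.
Proof.
move=> cov MB M2; have cE (X : {set V}) : X \subset supp w -> #|X| = (\sum_(v in supp w) (v \in X))%N.
  move=> XB; rewrite -sum1_card big_mkcond [RHS]big_mkcond; apply: eq_bigr => v _.
  by have := subsetP XB v; case: (v \in X) => [-> // | _]; case: (v \in supp w).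
rewrite /outside -w3 -[X in (_ <= X)%N]sum1_card !cE ?subsetDl // -!big_split /=.
apply: leq_sum => v vB; have := subsetP cov v vB; have := M2 v; rewrite !inE /=.
rewrite inE in vB; rewrite vB !andbT !orbF.
by case: (v \in M); case: (dot a v == 0); case: (dot b v == 0); case: (dot c v == 0);
  case: (dot d v == 0) => //= h1 h2; try (by have := h1 isT).
Qed.

Section Concurrent.
Variables a b c d A : V.
Hypotheses (aP : a \in points F) (bP : b \in points F) (cP : c \in points F).
Hypotheses (dP : d \in points F) (AP : A \in points F).
Hypotheses (ab : a != b) (ac : a != c) (bc : b != c).
Hypotheses (aA : dot a A = 0) (bA : dot b A = 0) (cA : dot c A = 0) (dA : dot d A != 0).
Hypothesis cov : supp w \subset union_lines [:: a; b; c; d].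

(** A further line through A has no support points except A and its intersection with d;
    [two_points] applies. *)
Lemma concurrent_mem : A \in supp w.
Proof.
have [m [mP mA]] := fresh_line (s := [:: a; b; c]) AP (ltnW (ltnW q4)).
rewrite !in_cons in_nil orbF !negb_or => /and3P[ma mb mc].
have md : m != d by apply: contraNneq dA => <-; rewrite mA.
have [D DP DE] := meet mP dP md.
have sub : [set A; D] \subset supp w.
  apply: (two_points mP); last by rewrite cards2; case: (A != D).
  apply/subsetP => v /setIP[vB]; rewrite inE => /eqP mv.
  have vP := subsetP wP v vB.
  have onA l : l \in points F -> m != l -> dot l A = 0 -> dot l v = 0 -> v \in [set A; D].
    by move=> lP ml lA lv; rewrite (meet_unique mP lP ml vP AP) // in_set2 eqxx.
  have := subsetP cov v vB; rewrite inE /= orbF => /or4P[] /eqP lv.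
  - exact: onA aP ma aA lv.
  - exact: onA bP mb bA lv.
  - exact: onA cP mc cA lv.
  - by have := DE v vP; rewrite mv lv !eqxx in_set2 => /esym ->; rewrite orbT.
exact: (subsetP sub) (set21 A D).
Qed.

(** Let v be on b, other than A and the intersection of b and d. The line joining v to x meets a and
    d only in x, so its support points are among v and its intersection with c, and v is one of
    them. This gives q + 1 - 2 points on b alone. *)
Lemma concurrent_exclusive x : x \in points F -> dot a x = 0 -> dot d x = 0 ->
  x \notin supp w -> (q <= (outside [:: a; c; d]).+1)%N.
Proof.
move=> xP ax dx xB.
have bd : b != d by apply: contraNneq dA => <-; rewrite bA.
have [y yP yE] := meet bP dP bd.
have Ax l : l \in points F -> a != l -> dot l A = 0 -> dot l x <> 0.
  move=> lP al lA lx; case/negP: dA.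
  by rewrite -(meet_unique aP lP al xP AP) // dx.
pose Z := [set v in points F | dot b v == 0] :\ A :\ y.
have cZ : (q <= #|Z|.+1)%N.
  have := card_line_points bP; rewrite (cardsD1 A).
  have := cardsD1 y ([set v in points F | dot b v == 0] :\ A); rewrite -/Z => ->.
  by case: (A \in _); case: (y \in _); lia_nat.
suff ZE : Z \subset supp w :\: union_lines [:: a; c; d].
  by apply: leq_trans cZ _; rewrite ltnS subset_leq_card.
apply/subsetP => v; rewrite in_setD1 in_setD1 in_set => /and4P[vy vA vP /eqP bv].
have av : dot a v != 0 by apply: contraNneq vA => av; rewrite (meet_unique aP bP ab vP AP).
have cv : dot c v != 0 by apply: contraNneq vA => cv; rewrite (meet_unique cP bP _ vP AP) // eq_sym.
have dv : dot d v != 0 by apply: contraNneq vy => dv; rewrite -yE // bv dv eqxx.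
rewrite in_setD inE /= !negb_or av cv dv /=.
have [m mP [mv mx]] := line_through_exists vP xP.
have ma : m != a by apply: contraNneq av => <-; rewrite mv.
have md : m != d by apply: contraNneq dv => <-; rewrite mv.
have mb : m != b by apply/eqP => mb; apply: (Ax b bP ab bA); rewrite -mb.
have mc : m != c by apply/eqP => mc; apply: (Ax c cP ac cA); rewrite -mc.
have [W WP WE] := meet mP cP mc.
have sub : [set v; W] \subset supp w.
  apply: (two_points mP); last by rewrite cards2; case: (v != W).
  apply/subsetP => u /setIP[uB]; rewrite inE => /eqP mu.
  have uP := subsetP wP u uB.
  have := subsetP cov u uB; rewrite inE /= orbF => /or4P[] /eqP lu.
  - by case/negP: xB; rewrite -(meet_unique mP aP ma uP xP).
  - by rewrite (meet_unique mP bP mb uP vP) // in_set2 eqxx.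
  - by have := WE u uP; rewrite mu lu !eqxx in_set2 => /esym ->; rewrite orbT.
  - by case/negP: xB; rewrite -(meet_unique mP dP md uP xP).
exact: (subsetP sub) (set21 v W).
Qed.

End Concurrent.

(** Otherwise b and c have q - 1 support points each of their own, and a and d have q - 2. If the
    intersection y of b and d is in the support, A and y are two more; if not, a also has q - 1 and
    A is one more. Either way 4q - 4 <= 3q, against q > 4. *)
Lemma concurrent_vertex a b c d A x : a \in points F -> b \in points F -> c \in points F ->
  d \in points F -> A \in points F -> a != b -> a != c -> b != c ->
  dot a A = 0 -> dot b A = 0 -> dot c A = 0 -> dot d A != 0 ->
  supp w \subset union_lines [:: a; b; c; d] ->
  ~~ (supp w \subset union_lines [:: a; b; c]) -> ~~ (supp w \subset union_lines [:: b; c; d]) ->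
  x \in points F -> dot a x = 0 -> dot d x = 0 -> x \in supp w.
Proof.
move=> aP bP cP dP AP ab ac bc aA bA cA dA cov nabc nbcd xP ax dx.
apply: contraT => xB; exfalso.
have AB := concurrent_mem aP bP cP dP AP aA bA cA dA cov.
have eb := concurrent_exclusive aP bP cP dP AP ab ac bc aA bA cA dA cov xP ax dx xB.
have cb : c != b by rewrite eq_sym.
have ba : b != a by rewrite eq_sym.
have cov1 : supp w \subset union_lines [:: a; c; b; d].
  by apply: union_linesS cov; rewrite /= !inE !eqxx ?orbT.
have cov2 : supp w \subset union_lines [:: b; a; c; d].
  by apply: union_linesS cov; rewrite /= !inE !eqxx ?orbT.
have ec := concurrent_exclusive aP cP bP dP AP ac ab cb aA cA bA dA cov1 xP ax dx xB.
have s3 : (3 <= q.-1)%N by lia_nat.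
have ea : (q.+1 <= outside [:: b; c; d] + 3)%N := @card_exclusive [:: b; c; d] s3 nbcd.
have ed : (q.+1 <= outside [:: a; b; c] + 3)%N := @card_exclusive [:: a; b; c] s3 nabc.
have bd : b != d by apply: contraNneq dA => <-; rewrite bA.
have [y yP yE] := meet bP dP bd.
have /andP[/eqP byy /eqP dy] : (dot b y == 0) && (dot d y == 0) by rewrite yE.
have [yB|yB] := boolP (y \in supp w).
  have MB : [set A; y] \subset supp w.
    by apply/subsetP => v; rewrite in_set2 => /orP[] /eqP ->.
  have m2 : forall v, v \in [set A; y] ->
      (1 < (dot a v == 0%R) + (dot b v == 0%R) + (dot c v == 0%R) + (dot d v == 0%R))%N.
    move=> v; rewrite in_set2 => /orP[] /eqP ->; first by rewrite aA bA cA eqxx.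
    by rewrite byy dy eqxx addnC; case: (dot a y == 0); case: (dot c y == 0).
  have := card_exclusive_sum cov MB m2.
  rewrite cards2; have -> : A != y by apply: contraNneq dA => ->; rewrite dy.
  by lia_nat.
have ea' := concurrent_exclusive bP aP cP dP AP ba bc ac bA aA cA dA cov2 yP byy dy yB.
have MB : [set A] \subset supp w by rewrite sub1set.
have m2 v : v \in [set A] ->
    (1 < (dot a v == 0%R) + (dot b v == 0%R) + (dot c v == 0%R) + (dot d v == 0%R))%N.
  by rewrite in_set1 => /eqP ->; rewrite aA bA cA eqxx.
have := card_exclusive_sum cov MB m2; rewrite cards1.
by lia_nat.
Qed.

(** If d passes through A, a fifth line through A has at most the support point A. Otherwise A and
    the three intersections with d are in the support, and q - 2 points on each line alone again
    give 4q - 4 <= 3q. *)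
Lemma concurrent_false a b c d A : a \in points F -> b \in points F -> c \in points F ->
  d \in points F -> A \in points F -> a != b -> a != c -> b != c ->
  dot a A = 0 -> dot b A = 0 -> dot c A = 0 ->
  supp w \subset union_lines [:: a; b; c; d] ->
  ~~ (supp w \subset union_lines [:: a; b; c]) -> ~~ (supp w \subset union_lines [:: a; b; d]) ->
  ~~ (supp w \subset union_lines [:: a; c; d]) -> ~~ (supp w \subset union_lines [:: b; c; d]) ->
  False.
Proof.
move=> aP bP cP dP AP ab ac bc aA bA cA cov nabc nabd nacd nbcd.
have onA l m : l \in points F -> m \in points F -> l != m -> dot l A = 0 -> dot m A = 0 ->
    forall v, v \in supp w -> dot l v = 0 -> dot m v = 0 -> v = A.
  move=> lP mP lm lA mA v vB lv mv.
  exact: meet_unique lP mP lm (subsetP wP v vB) AP lv mv lA mA.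
have [dA|dA] := eqVneq (dot d A) 0.
  have [m [mP mA]] := fresh_line (s := [:: a; b; c; d]) AP (ltnW q4).
  rewrite !in_cons in_nil orbF !negb_or => /and4P[ma mb mc md].
  have /subset_leq_card : supp w :&: zeros (dot m) \subset [set A].
    apply/subsetP => v /setIP[vB]; rewrite inE in_set1 => /eqP mv.
    have := subsetP cov v vB; rewrite inE /= orbF => /or4P[] /eqP lv.
    - by rewrite (onA m a mP aP ma mA aA v vB mv lv).
    - by rewrite (onA m b mP bP mb mA bA v vB mv lv).
    - by rewrite (onA m c mP cP mc mA cA v vB mv lv).
    - by rewrite (onA m d mP dP md mA dA v vB mv lv).
  by rewrite cards1 leqNgt w2.
have meetd l : l \in points F -> dot l A = 0 ->
    exists x, [/\ x \in points F, dot l x = 0, dot d x = 0 & x != A].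
  move=> lP lA; have [|x xP] := @meet l d lP dP.
    by apply: contraNneq dA => <-; rewrite lA.
  move=> /(_ x xP); rewrite eqxx => /andP[/eqP lx /eqP dx].
  by exists x; split=> //; apply: contraNneq dA => <-; rewrite dx.
have [x [xP ax dx xA]] := meetd a aP aA.
have [y [yP byy dy yA]] := meetd b bP bA.
have [z [zP cz dz zA]] := meetd c cP cA.
have xB := concurrent_vertex aP bP cP dP AP ab ac bc aA bA cA dA cov nabc nbcd xP ax dx.
have yB : y \in supp w.
  apply: (@concurrent_vertex b a c d A) => //; first by rewrite eq_sym.
    by apply: union_linesS cov; rewrite /= !inE !eqxx ?orbT.
  by apply: contra nabc; apply: union_linesS; rewrite /= !inE !eqxx ?orbT.
have zB : z \in supp w.
  apply: (@concurrent_vertex c a b d A) => //; rewrite 1?eq_sym //.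
    by apply: union_linesS cov; rewrite /= !inE !eqxx ?orbT.
  by apply: contra nabc; apply: union_linesS; rewrite /= !inE !eqxx ?orbT.
have AB := concurrent_mem aP bP cP dP AP aA bA cA dA cov.
have diff l m u v : l \in points F -> m \in points F -> l != m -> dot l A = 0 -> dot m A = 0 ->
    u \in supp w -> dot l u = 0 -> dot m v = 0 -> u != A -> u != v.
  move=> lP mP lm lA mA uB lu mv; apply: contraNneq => uv.
  by apply/eqP; apply: (onA l m lP mP lm lA mA u uB lu); rewrite uv.
have s3 : (3 <= q.-1)%N by lia_nat.
have ea : (q.+1 <= outside [:: b; c; d] + 3)%N := @card_exclusive [:: b; c; d] s3 nbcd.
have eb : (q.+1 <= outside [:: a; c; d] + 3)%N := @card_exclusive [:: a; c; d] s3 nacd.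
have ec : (q.+1 <= outside [:: a; b; d] + 3)%N := @card_exclusive [:: a; b; d] s3 nabd.
have ed : (q.+1 <= outside [:: a; b; c] + 3)%N := @card_exclusive [:: a; b; c] s3 nabc.
have MB : A |: (x |: [set y; z]) \subset supp w.
  by apply/subsetP => v; rewrite !in_setU !in_set1 => /or4P[] /eqP ->.
have m2 v : v \in A |: (x |: [set y; z]) ->
    (1 < (dot a v == 0%R) + (dot b v == 0%R) + (dot c v == 0%R) + (dot d v == 0%R))%N.
  rewrite !in_setU !in_set1 => /or4P[] /eqP ->.
  + by rewrite aA bA cA eqxx.
  + by rewrite ax dx eqxx addn1.
  + by rewrite byy dy eqxx addn1 addnAC addn1.
  + by rewrite cz dz eqxx !addn1.
have := card_exclusive_sum cov MB m2; rewrite !cardsU1 cards1 !in_setU !in_set1 !negb_or.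
have -> : y != z := diff b c y z bP cP bc bA cA yB byy cz yA.
have -> : x != y := diff a b x y aP bP ab aA bA xB ax byy xA.
have -> : x != z := diff a c x z aP cP ac aA cA xB ax cz xA.
rewrite ![A == _]eq_sym xA yA zA.
by lia_nat.
Qed.

Definition three_lines := exists a b c,
  [/\ a \in points F, b \in points F, c \in points F & supp w \subset union_lines [:: a; b; c]].

(** The line joining A to the intersection D of c and d meets the four lines only in A and D. *)
Lemma opposite_mem a b c d A : a \in points F -> b \in points F -> c \in points F ->
  d \in points F -> A \in points F -> a != b -> c != d -> dot a A = 0 -> dot b A = 0 ->
  supp w \subset union_lines [:: a; b; c; d] ->
  (forall x, x \in points F -> ~ [/\ dot a x = 0, dot c x = 0 & dot d x = 0]) ->
  (forall x, x \in points F -> ~ [/\ dot b x = 0, dot c x = 0 & dot d x = 0]) ->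
  (forall x, x \in points F -> ~ [/\ dot a x = 0, dot b x = 0 & dot c x = 0]) ->
  (forall x, x \in points F -> ~ [/\ dot a x = 0, dot b x = 0 & dot d x = 0]) ->
  A \in supp w.
Proof.
move=> aP bP cP dP AP ab cd aA bA cov acd bcd abc abd.
have [D DP /(_ D DP)] := meet cP dP cd; rewrite eqxx => /andP[/eqP cD /eqP dD].
have [m mP [mA mD]] := line_through_exists AP DP.
have ma : m != a by apply/eqP => e; apply: (acd D) => //; rewrite -e.
have mb : m != b by apply/eqP => e; apply: (bcd D) => //; rewrite -e.
have mc : m != c by apply/eqP => e; apply: (abc A) => //; split=> //; rewrite -e.
have md : m != d by apply/eqP => e; apply: (abd A) => //; split=> //; rewrite -e.
have sub : [set A; D] \subset supp w.
  apply: (two_points mP); last by rewrite cards2; case: (A != D).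
  apply/subsetP => v /setIP[vB]; rewrite inE => /eqP mv.
  have vP := subsetP wP v vB.
  have := subsetP cov v vB; rewrite inE /= orbF => /or4P[] /eqP lv.
  - by rewrite (meet_unique mP aP ma vP AP) // set21.
  - by rewrite (meet_unique mP bP mb vP AP) // set21.
  - by rewrite (meet_unique mP cP mc vP DP) // set22.
  - by rewrite (meet_unique mP dP md vP DP) // set22.
exact: (subsetP sub) (set21 A D).
Qed.

(** If all four lines are needed, no three are concurrent, and four of the six intersections
    together with q - 2 points on each line alone exceed 3q. *)
Lemma four_lines a b c d : a \in points F -> b \in points F -> c \in points F ->
  d \in points F -> supp w \subset union_lines [:: a; b; c; d] -> three_lines.
Proof.
move=> aP bP cP dP cov.
have [h|nabc] := boolP (supp w \subset union_lines [:: a; b; c]); first by exists a, b, c.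
have [h|nabd] := boolP (supp w \subset union_lines [:: a; b; d]); first by exists a, b, d.
have [h|nacd] := boolP (supp w \subset union_lines [:: a; c; d]); first by exists a, c, d.
have [h|nbcd] := boolP (supp w \subset union_lines [:: b; c; d]); first by exists b, c, d.
exfalso.
have neq x y z t s : supp w \subset union_lines [:: x; y; z; t] ->
    ~~ (supp w \subset union_lines s) -> y \in s -> z \in s -> t \in s -> x \notin s.
  move=> h ns ys zs ts; apply: contra ns => xs.
  by apply: union_linesS h; rewrite /= xs ys zs ts.
have cov2 : supp w \subset union_lines [:: b; a; c; d].
  by apply: union_linesS cov; rewrite /= !inE !eqxx ?orbT.
have cov3 : supp w \subset union_lines [:: c; a; b; d].
  by apply: union_linesS cov; rewrite /= !inE !eqxx ?orbT.
have := neq _ _ _ _ _ cov nbcd; rewrite !inE !eqxx !orbT !negb_or => /(_ isT isT isT).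
move=> /and3P[ab ac ad].
have := neq _ _ _ _ _ cov2 nacd; rewrite !inE !eqxx !orbT !negb_or => /(_ isT isT isT).
move=> /and3P[_ bc bd].
have := neq _ _ _ _ _ cov3 nabd; rewrite !inE !eqxx !orbT !negb_or => /(_ isT isT isT).
move=> /and3P[_ _ cd].
have perm s t : all (mem t) s -> supp w \subset union_lines s -> supp w \subset union_lines t.
  exact: union_linesS.
have abc x : x \in points F -> ~ [/\ dot a x = 0, dot b x = 0 & dot c x = 0].
  by move=> xP [ax bx cx]; apply: (@concurrent_false a b c d x).
have abd x : x \in points F -> ~ [/\ dot a x = 0, dot b x = 0 & dot d x = 0].
  move=> xP [ax bx cx]; apply: (@concurrent_false a b d c x) => //.
  - by apply: perm cov; rewrite /= !inE !eqxx ?orbT.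
  - by apply: contra nacd; apply: perm; rewrite /= !inE !eqxx ?orbT.
  - by apply: contra nbcd; apply: perm; rewrite /= !inE !eqxx ?orbT.
have acd x : x \in points F -> ~ [/\ dot a x = 0, dot c x = 0 & dot d x = 0].
  move=> xP [ax bx cx]; apply: (@concurrent_false a c d b x) => //.
  - by apply: perm cov; rewrite /= !inE !eqxx ?orbT.
  - by apply: contra nabc; apply: perm; rewrite /= !inE !eqxx ?orbT.
  - by apply: contra nabd; apply: perm; rewrite /= !inE !eqxx ?orbT.
  - by apply: contra nbcd; apply: perm; rewrite /= !inE !eqxx ?orbT.
have bcd x : x \in points F -> ~ [/\ dot b x = 0, dot c x = 0 & dot d x = 0].
  move=> xP [ax bx cx]; apply: (@concurrent_false b c d a x) => //.
  - by apply: perm cov; rewrite /= !inE !eqxx ?orbT.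
  - by apply: contra nabc; apply: perm; rewrite /= !inE !eqxx ?orbT.
  - by apply: contra nabd; apply: perm; rewrite /= !inE !eqxx ?orbT.
  - by apply: contra nacd; apply: perm; rewrite /= !inE !eqxx ?orbT.
have on l m (lP : l \in points F) (mP : m \in points F) (lm : l != m) :
    exists x, [/\ x \in points F, dot l x = 0 & dot m x = 0].
  have [x xP /(_ x xP)] := meet lP mP lm; rewrite eqxx => /andP[/eqP lx /eqP mx].
  by exists x.
have [x [xP ax bx]] := on a b aP bP ab.
have [y [yP ay cy]] := on a c aP cP ac.
have [z [zP az dz]] := on a d aP dP ad.
have [t [tP bt ct]] := on b c bP cP bc.
have xB : x \in supp w by apply: (@opposite_mem a b c d).
have yB : y \in supp w.
  apply: (@opposite_mem a c b d) => //.
  - by apply: perm cov; rewrite /= !inE !eqxx ?orbT.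
  - by move=> v vP [cv bv dv]; apply: (bcd v vP).
  - by move=> v vP [av cv bv]; apply: (abc v vP).
have zB : z \in supp w.
  apply: (@opposite_mem a d b c) => //.
  - by apply: perm cov; rewrite /= !inE !eqxx ?orbT.
  - by move=> v vP [dv bv cv]; apply: (bcd v vP).
  - by move=> v vP [av dv bv]; apply: (abd v vP).
  - by move=> v vP [av dv cv]; apply: (acd v vP).
have tB : t \in supp w.
  apply: (@opposite_mem b c a d) => //.
  - by apply: perm cov; rewrite /= !inE !eqxx ?orbT.
  - by move=> v vP [bv av dv]; apply: (abd v vP).
  - by move=> v vP [cv av dv]; apply: (acd v vP).
  - by move=> v vP [bv cv av]; apply: (abc v vP).
have s3 : (3 <= q.-1)%N by lia_nat.
have ea : (q.+1 <= outside [:: b; c; d] + 3)%N := @card_exclusive [:: b; c; d] s3 nbcd.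
have eb : (q.+1 <= outside [:: a; c; d] + 3)%N := @card_exclusive [:: a; c; d] s3 nacd.
have ec : (q.+1 <= outside [:: a; b; d] + 3)%N := @card_exclusive [:: a; b; d] s3 nabd.
have ed : (q.+1 <= outside [:: a; b; c] + 3)%N := @card_exclusive [:: a; b; c] s3 nabc.
have MB : x |: (y |: [set z; t]) \subset supp w.
  by apply/subsetP => v; rewrite !in_setU !in_set1 => /or4P[] /eqP ->.
have m2 v : v \in x |: (y |: [set z; t]) ->
    (1 < (dot a v == 0%R) + (dot b v == 0%R) + (dot c v == 0%R) + (dot d v == 0%R))%N.
  rewrite !in_setU !in_set1 => /or4P[] /eqP ->.
  + by rewrite ax bx eqxx.
  + by rewrite ay cy eqxx; case: (dot b y == 0).
  + by rewrite az dz eqxx !addn1.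
  + by rewrite bt ct eqxx; case: (dot a t == 0).
have := card_exclusive_sum cov MB m2; rewrite !cardsU1 cards1 !in_setU !in_set1 !negb_or.
have -> : x != y by apply/eqP => e; apply: (abc x xP); split=> //; rewrite e.
have -> : x != z by apply/eqP => e; apply: (abd x xP); split=> //; rewrite e.
have -> : x != t by apply/eqP => e; apply: (abc x xP); split=> //; rewrite e.
have -> : y != z by apply/eqP => e; apply: (acd y yP); split=> //; rewrite e.
have -> : y != t by apply/eqP => e; apply: (abc y yP); split=> //; rewrite e.
have -> : z != t by apply/eqP => e; apply: (abc z zP); split=> //; rewrite e.
by lia_nat.
Qed.

End LineCovers.

(** * Lines rich in support points, and the cover by three lines *)

Section TriangleCover.
Variable F : finFieldType.
Local Notation V := {ffun 'I_3 -> F}.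
Local Notation weight := {ffun V -> F}.
Local Notation q := #|F|.
Implicit Types (a b c d l m u v x y : V) (R S : {set V}) (k : nat) (s : seq V).

(** Translation by 1 permutes F and adds q to the sum of its elements. *)
Lemma natr_card_eq0 : q%:R = 0 :> F.
Proof.
have e : \sum_(x : F) x = \sum_(x : F) x + q%:R.
  rewrite {1}(reindex (fun x : F => x + 1)) /=; last by exists (fun x : F => x - 1) => x _; rewrite ?addrK ?subrK.
  by rewrite big_split /= sumr_const.
by apply: (addrI (\sum_(x : F) x)); rewrite -e addr0.
Qed.

Lemma card_neq6 : q != 6%N.
Proof.
have [p p_pr pF] := finPcharP F.
apply/eqP => q6; have := card_pprimeChar pF; rewrite q6.
have [|p6] := leqP p 6; last first.
  by rewrite (eqP (_ : logn p 6 == 0)) // -leqn0 leqNgt logn_gt0 mem_primes p_pr /= gtnNdvd.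
by case: p {p_pr pF} => [|[|[|[|[|[|[|p]]]]]]].
Qed.

Variable w : weight.
Hypothesis q4 : (4 < q)%N.
Hypothesis wP : supp w \subset points F.
Hypothesis dw : dep q.-1 w.
Hypothesis w3 : #|supp w| = (3 * q)%N.
Hypothesis w2 : forall a, a \in points F -> (1 < #|supp w :&: zeros (dot a)|)%N.
Hypothesis w0 : forall a, a \in points F -> \sum_(v | dot a v == 0) w v = 0.

Let rest s : {set V} := supp w :\: union_lines s.

Let out s : nat := outside w s.

Definition extra s a := #|rest s :&: zeros (dot a)|.

Lemma restP s : rest s \subset points F.
Proof. exact: subset_trans (subsetDl _ _) wP. Qed.

Lemma rest0 : rest [::] = supp w.
Proof. by apply/setP => v; rewrite !inE. Qed.

Lemma rest_cons a s : rest (a :: s) = rest s :\: zeros (dot a).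
Proof. by apply/setP => v; rewrite !inE /= negb_or andbA. Qed.

Lemma outside_cons a s : (extra s a + out (a :: s) = out s)%N.
Proof. by rewrite /out /outside -/(rest (a :: s)) rest_cons cardsID. Qed.

Lemma outside_nil : out [::] = (3 * q)%N.
Proof. by rewrite -w3 -rest0. Qed.

Lemma extra_nil a : extra [::] a = #|supp w :&: zeros (dot a)|.
Proof. by rewrite /extra rest0. Qed.

Lemma card_meet R a b : R \subset points F -> a \in points F -> b \in points F -> a != b ->
  (#|R :&: zeros (dot a) :&: zeros (dot b)| <= 1)%N.
Proof.
move=> /subsetP RP aP bP ab; have [x xP xE] := meet aP bP ab.
rewrite -[X in (_ <= X)%N](cards1 x); apply/subset_leq_card/subsetP => v /setIP[/setIP[vR]].
by rewrite !inE => av bv; rewrite -xE ?av ?bv // RP.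
Qed.

Lemma extra_cons a b s : a \in points F -> b \in points F -> a != b ->
  (extra s b <= (extra (a :: s) b).+1)%N.
Proof.
move=> aP bP ab; rewrite /extra rest_cons -(cardsID (zeros (dot a)) (rest s :&: zeros (dot b))).
have := card_meet (restP s) bP aP; rewrite eq_sym ab => /(_ isT).
by rewrite setIDAC; lia_nat.
Qed.

Lemma extra_ge s b : {subset s <= points F} -> b \in points F -> b \notin s ->
  (extra [::] b <= extra s b + size s)%N.
Proof.
elim: s => [|a s IH] sP bP; first by rewrite addn0.
rewrite in_cons negb_or => /andP[ba bs].
have := IH (fun x xs => sP x (mem_behead (s := a :: s) xs)) bP bs.
have := @extra_cons a b s (sP a (mem_head _ _)) bP; rewrite eq_sym ba => /(_ isT) /=.
by rewrite addnS -addSn; lia_nat.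
Qed.

Lemma extra_le s a : (extra s a <= extra [::] a)%N.
Proof.
rewrite extra_nil; apply/subset_leq_card; apply: setSI; exact: subsetDl.
Qed.

Lemma extra_le_line a : a \in points F -> (extra [::] a <= q.+1)%N.
Proof.
move=> aP; rewrite -(card_line_points aP) extra_nil; apply/subset_leq_card/subsetP => v.
by rewrite in_setI => /andP[vB]; rewrite inE in_set (subsetP wP v vB).
Qed.

Lemma extra_self a : extra [:: a] a = 0%N.
Proof.
by apply/eqP; rewrite cards_eq0; apply/eqP/setP => v; rewrite !inE /=; case: (dot a v == 0); rewrite ?andbF.
Qed.

Lemma outside1 a : (out [:: a] + extra [::] a = 3 * q)%N.
Proof. by rewrite addnC outside_cons outside_nil. Qed.

Lemma extra_count s (c d : int) :
  \sum_(a in points F) ((extra s a)%:Z ^+ 2 - c * (extra s a)%:Z + d) =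
  (out s)%:Z * ((out s)%:Z + q%:Z) - c * ((out s)%:Z * (q%:Z + 1))
  + d * (q%:Z ^+ 2 + q%:Z + 1).
Proof. exact: quadratic_count (restP s). Qed.

(** Seven is the gain needed: 3q - 7 < 3(q - 2). As a has at most q + 1 points, at least 2q - 1 >= q
    + 3 remain, so the conic splits. *)
Lemma cover_heavy a : a \in points F -> (6 < extra [::] a)%N -> three_lines w.
Proof.
move=> aP a6; have := outside1 a; have := extra_le_line aP => le e.
have s1 : (1 <= q.-1)%N by lia_nat.
have s2 : (out [:: a] < 3 * (q.-1 - 1))%N by lia_nat.
have s3 : (q + 3 <= out [:: a])%N by lia_nat.
have [b [c [bP cP cov]]] := @cover_conic F w wP dw [:: a] s1 s2 s3.
by exists b, c, a.
Qed.

(* Otherwise (i - 1)(i - 3) <= 0 for the number i of remaining points on each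
   line other than a, against the total 3 (q - 4)(q - 5). *)
Lemma extra_four a : a \in points F -> (6 < q)%N -> extra [::] a = 6%N ->
  exists2 b : V, b \in points F & (3 < extra [:: a] b)%N.
Proof.
move=> aP q6 a6.
have [/existsP[b /andP[bP b3]]|/existsPn h] :=
  boolP [exists b, (b \in points F) && (3 < extra [:: a] b)%N]; first by exists b.
have := extra_count [:: a] 4 3; have := outside1 a; rewrite a6.
rewrite (bigD1 a) //= extra_self.
set s := \sum_(_ | _) _; have : s <= 0.
  apply: Num.Theory.sumr_le0 => b /andP[bP ba].
  have := h b; rewrite bP -leqNgt /= => b3.
  have b1 : (extra [::] b <= extra [:: a] b + 1)%N.
    by apply: (@extra_ge [:: a] b) => // [x|]; rewrite mem_seq1 // => /eqP ->.
  have := w2 bP; rewrite -extra_nil; move: b3 b1.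
  by case: (extra [:: a] b) => [|[|[|[|]]]] //=; lia_nat.
move: s => s; move: (out _) q6; move: #|F| => n o n6 s0 eo.
have [k ek] : exists k, n = (k + 7)%N by exists (n - 7)%N; lia.
have -> : o = (3 * k + 15)%N by lia.
rewrite ek !PoszD => e; exfalso; move: s0 e; clear.
by have : (0 <= k%:Z) by []; move: (k%:Z) => z; nia.
Qed.

(** At least 6 + 4 points are removed, leaving fewer than 3(q - 3). These lie on two lines if they
    number q + 3 or more, and otherwise on one, because q + 2 <= 2(q - 3) + 1 for q >= 7. *)
Lemma cover_max6 a : a \in points F -> (6 < q)%N ->
  (forall b, b \in points F -> (extra [::] b <= 6)%N) -> extra [::] a = 6%N -> three_lines w.
Proof.
move=> aP q6 max6 a6; have [b bP b3] := extra_four aP q6 a6.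
have ob := outside_cons b [:: a]; have oa := outside1 a.
have b6 : (extra [:: a] b <= 6)%N := leq_trans (extra_le _ _) (max6 b bP).
have s1 : (2 <= q.-1)%N by lia_nat.
have [small|big] := ltnP (out [:: b; a]) (q + 3).
  have s2 : (out [:: b; a] <= (q.-1 - 2).*2.+1)%N by lia_nat.
  have [c cP cov] := @cover_line F w wP dw [:: b; a] s1 s2.
  by exists c, b, a.
have s2 : (out [:: b; a] < 3 * (q.-1 - 2))%N by lia_nat.
have [c [d [cP dP cov]]] := @cover_conic F w wP dw [:: b; a] s1 s2 big.
exact: four_lines cov.
Qed.

Lemma disjoint_pair a b : a \in points F -> b \in points F -> (6 < q)%N ->
  extra [::] a = 5%N -> extra [:: a] b = 5%N -> three_lines w.
Proof.
move=> aP bP q6 a5 b5; have ob := outside_cons b [:: a]; have oa := outside1 a.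
have s1 : (2 <= q.-1)%N by lia_nat.
have s2 : (out [:: b; a] < 3 * (q.-1 - 2))%N by lia_nat.
have s3 : (q + 3 <= out [:: b; a])%N by lia_nat.
have [c [d [cP dP cov]]] := @cover_conic F w wP dw [:: b; a] s1 s2 s3.
exact: four_lines cov.
Qed.

Definition heavy : {set V} := [set a in points F | extra [::] a == 5%N].

Lemma in_heavy a : (a \in heavy) = (a \in points F) && (extra [::] a == 5%N).
Proof. by rewrite [LHS]in_set. Qed.

Lemma heavyP a : reflect (a \in points F /\ extra [::] a = 5%N) (a \in heavy).
Proof. by rewrite in_heavy; apply: (iffP andP) => -[aP /eqP]. Qed.

(** For i points on a line, (i - 2)(i - 4) is at most 0 if 2 <= i <= 4 and is 3 if i = 5; the total
    over all lines is 2q^2 - 10q + 8. *)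
Lemma card_heavy : (forall b, b \in points F -> (extra [::] b <= 5)%N) ->
  (2 * q ^ 2 + 8 <= 3 * #|heavy| + 10 * q)%N.
Proof.
move=> max5; have := extra_count [::] 6 8; rewrite outside_nil => e.
have : \sum_(a in points F) ((extra [::] a)%:Z ^+ 2 - 6 * (extra [::] a)%:Z + 8) <=
    \sum_(a in points F) (3 * (a \in heavy))%N%:Z.
  apply: Num.Theory.ler_sum => a aP; have := max5 a aP; have := w2 aP.
  rewrite -extra_nil in_heavy aP /=.
  by case: (extra [::] a) => [|[|[|[|[|[|]]]]]].
have -> : \sum_(a in points F) (3 * (a \in heavy))%N%:Z = (3 * #|heavy|)%N%:Z.
  rewrite -(big_morph Posz PoszD (erefl _)) -big_distrr /= -sum1_card.
  congr (3 * _)%N%:Z; rewrite big_mkcond [RHS]big_mkcond; apply: eq_bigr => a _.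
  by rewrite in_heavy; case: (a \in points F).
rewrite e; clear; move: #|heavy| => h; move: q => n; rewrite -mulnn; nia.
Qed.

(** Each term (i - 2)(i - 5) is at most 0, and the total is (q - 1)(q - 10). *)
Lemma max5_card : (forall b, b \in points F -> (extra [::] b <= 5)%N) -> (q <= 10)%N.
Proof.
move=> max5; have := extra_count [::] 7 10; rewrite outside_nil => e.
have : \sum_(a in points F) ((extra [::] a)%:Z ^+ 2 - 7 * (extra [::] a)%:Z + 10) <= 0.
  apply: Num.Theory.sumr_le0 => a aP; have := max5 a aP; have := w2 aP.
  rewrite -extra_nil.
  by case: (extra [::] a) => [|[|[|[|[|[|]]]]]].
rewrite e; clear; move: q => n; nia.
Qed.

Lemma extra_pencil x : x \in supp w ->
  (\sum_(a in points F | dot a x == 0%R) extra [::] a = 4 * q)%N.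
Proof.
move=> xB; under eq_bigr => a _ do rewrite extra_nil.
by rewrite pencil_count_mem // w3; lia.
Qed.

(** Each five-point line through x exceeds by three the minimum of two points per line. *)
Lemma heavy_pencil x : x \in supp w ->
  (3 * #|[set a in heavy | dot a x == 0%R]| + 2 * q.+1 <= 4 * q)%N.
Proof.
move=> xB; rewrite -(extra_pencil xB) -(card_pencil (subsetP wP x xB)).
have -> : (2 * #|[set a in points F | dot a x == 0%R]| =
    \sum_(a in points F | dot a x == 0%R) 2)%N.
  by rewrite sum_nat_const mulnC cardsE.
have -> : (3 * #|[set a in heavy | dot a x == 0%R]| =
    \sum_(a in points F | dot a x == 0%R) 3 * (a \in heavy))%N.
  rewrite -big_distrr /= -sum1dep_card; congr (3 * _)%N.
  rewrite big_mkcond [RHS]big_mkcond; apply: eq_bigr => a _.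
  by rewrite in_heavy; case: (a \in points F); case: (dot a x == 0); case: (_ == _).
rewrite -big_split; apply: leq_sum => a /andP[aP ax] /=; have := w2 aP.
by rewrite -extra_nil in_heavy aP /=; case: eqP => [->|] //= _; lia_nat.
Qed.

(** Every other five-point line meets a in one of its five support points, and each of these is on
    at most m such lines. *)
Lemma heavy_meet a (m : nat) : a \in heavy ->
  (forall b, b \in heavy -> b != a -> (extra [:: a] b < 5)%N) ->
  (forall x, x \in supp w -> dot a x = 0 -> (#|[set b in heavy | dot b x == 0%R]| <= m.+1)%N) ->
  (#|heavy| <= (5 * m).+1)%N.
Proof.
move=> ah meets le; have /heavyP[aP a5] := ah.
have -> : #|heavy| = #|heavy :\ a|.+1 by rewrite (cardsD1 a) ah.
rewrite ltnS -a5 extra_nil -sum_nat_const -sum1_card.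
apply: (@leq_trans (\sum_(b in heavy :\ a) \sum_(x in supp w :&: zeros (dot a)) (dot b x == 0%R))%N).
  apply: leq_sum => b; rewrite in_setD1 => /andP[ba bh].
  have /heavyP[bP b5] := bh; have := meets b bh ba.
  rewrite -card_lineE -b5 extra_nil /extra rest_cons rest0.
  have := cardsID (zeros (dot a)) (supp w :&: zeros (dot b)).
  by rewrite setIDAC setIAC; lia_nat.
rewrite exchange_big; apply: leq_sum => x /setIP[xB]; rewrite inE => /eqP ax.
have := le x xB ax; rewrite (cardsD1 a) in_set ah ax eqxx /= ltnS; apply: leq_trans.
apply: eq_leq; rewrite -sum1_card big_mkcond [RHS]big_mkcond; apply: eq_bigr => b _.
by rewrite !in_setD1 [in RHS]in_set; case: (b == a); case: (b \in heavy); case: (dot b x == 0).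
Qed.

Lemma line_sum a : a \in points F -> \sum_(v in supp w :&: zeros (dot a)) w v = 0.
Proof.
move=> aP; rewrite -[RHS](w0 aP) big_mkcond [RHS]big_mkcond; apply: eq_bigr => v _.
by rewrite !inE; have [->|] := eqVneq (w v) 0 => //=; case: (dot a v == 0).
Qed.

Lemma concurrent_rest x l s : x \in supp w -> l \in points F -> dot l x = 0 -> l \notin s ->
  {subset s <= points F} -> (forall b, b \in s -> dot b x = 0) -> s != [::] ->
  rest s :&: zeros (dot l) = (supp w :&: zeros (dot l)) :\ x.
Proof.
move=> xB lP lx ls sP sx s0; have xP := subsetP wP x xB; apply/setP => v.
rewrite in_setI {1}/rest in_setD in_setD1 in_setI.
case: (boolP (v \in supp w)) => [vB|]; rewrite ?andbF //=.
case: (boolP (v \in zeros (dot l))) => [|]; rewrite ?andbF // !andbT inE => /eqP lv.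
rewrite inE; congr (~~ _); apply/hasP/eqP => [[b bs /eqP bv]|->].
  have lb : l != b by apply: contraNneq ls => ->.
  exact: meet_unique lP (sP b bs) lb (subsetP wP v vB) xP lv bv lx (sx b bs).
by case: s s0 sx {ls sP} => // b s _ sx; exists b; [|apply/eqP/sx]; apply: mem_head.
Qed.

Lemma concurrent_extra x l s : x \in supp w -> l \in points F -> dot l x = 0 -> l \notin s ->
  {subset s <= points F} -> (forall b, b \in s -> dot b x = 0) -> s != [::] ->
  (extra s l).+1 = extra [::] l.
Proof.
move=> xB lP lx ls sP sx s0; rewrite /extra (concurrent_rest xB lP lx) // rest0.
by rewrite (cardsD1 x (supp w :&: _)) in_setI xB inE lx eqxx.
Qed.

(* If four lines with five points of the support each meet in a point x of the
   support, then the four remaining points are the points of the support on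
   some line and each is joined to x by a line with no further point. Hence
   they all have weight - w x, and 4 (w x) = 0. *)
Lemma no_four_concurrent x s : q = 7%N -> x \in supp w -> uniq s -> size s = 4%N ->
  {subset s <= heavy} -> (forall b, b \in s -> dot b x = 0) -> False.
Proof.
move=> q7 xB us s4 sh sx.
have sP : {subset s <= points F} by move=> b /sh /heavyP[].
have s5 b : b \in s -> extra [::] b = 5%N by move=> /sh /heavyP[].
have xP := subsetP wP x xB.
(* The four lines share only x, so 5 + 4 + 4 + 4 = 17 of the 21 support points are deleted. *)
have out_s : out s = 4%N.
  case: s us s4 sh sx sP s5 => [|a1 [|a2 [|a3 [|a4 []]]]] // us _ sh sx sP s5.
  have in1 : a1 \in [:: a1; a2; a3; a4] by rewrite mem_head.
  have in2 : a2 \in [:: a1; a2; a3; a4] by rewrite !inE eqxx ?orbT.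
  have in3 : a3 \in [:: a1; a2; a3; a4] by rewrite !inE eqxx ?orbT.
  have in4 : a4 \in [:: a1; a2; a3; a4] by rewrite !inE eqxx ?orbT.
  have step (l : V) (t : seq V) : l \in [:: a1; a2; a3; a4] -> {subset t <= [:: a1; a2; a3; a4]} ->
      l \notin t -> t != [::] -> (out (l :: t) + 4 = out t)%N.
    move=> lin tin lt t0; rewrite -(outside_cons l t) addnC; congr (_ + _)%N.
    have := concurrent_extra xB (sP _ lin) (sx _ lin) lt (fun b bt => sP b (tin b bt))
      (fun b bt => sx b (tin b bt)) t0.
    by rewrite (s5 _ lin) => -[].
  have := us; rewrite /= !inE !negb_or => /and4P[/and3P[n12 n13 n14] /andP[n23 n24] n34 _].
  have e4 : (out [:: a4] + 5 = 3 * q)%N by rewrite -(s5 _ in4) outside1.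
  have e3 : (out [:: a3; a4] + 4 = out [:: a4])%N.
    by apply: step; rewrite ?mem_seq1 // => b; rewrite mem_seq1 => /eqP ->.
  have e2 : (out [:: a2; a3; a4] + 4 = out [:: a3; a4])%N.
    apply: step; rewrite // ?inE ?negb_or ?n23 ?n24 // => b.
    by rewrite !inE => /orP[] /eqP ->; rewrite eqxx ?orbT.
  have e1 : (out [:: a1; a2; a3; a4] + 4 = out [:: a2; a3; a4])%N.
    apply: step; rewrite // ?inE ?negb_or ?n12 ?n13 ?n14 // => b.
    by rewrite !inE => /or3P[] /eqP ->; rewrite eqxx ?orbT.
  by lia_nat.
have sq : (size s <= q.-1)%N by rewrite s4 q7.
have small : (out s <= (q.-1 - size s).*2.+1)%N by rewrite out_s s4 q7.
have [l lP cov] := @cover_line F w wP dw s sq small.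
have rest_l : rest s \subset zeros (dot l).
  apply/subsetP => v; rewrite in_setD => /andP[vs vB].
  by have := subsetP cov v vB; rewrite !inE /= in vs *; rewrite (negPf vs) orbF.
(* The 8 lines through x total 4q = 28. Those of s account for 20, and the other four have at least
   two each, hence exactly two. *)
have light m : m \in points F -> dot m x = 0 -> m \notin s -> (extra [::] m <= 2)%N.
  move=> mP mx ms; have := extra_pencil xB.
  have le : (\sum_(a in points F | dot a x == 0%R) (2 + (3 * (a \in s) +
      (a == m) * (extra [::] m - 2))) <= \sum_(a in points F | dot a x == 0%R) extra [::] a)%N.
    apply: leq_sum => a /andP[aP ax]; have := w2 aP; rewrite -extra_nil.
    have [as_|as_] := boolP (a \in s).
      have -> : a == m = false by apply: contraNF ms => /eqP <-.
      by rewrite (s5 _ as_).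
    by have [->|_] := eqVneq a m; rewrite ?mul1n ?mul0n; lia_nat.
  move: le; rewrite 2!big_split sum_nat_const (_ : #|_| = q.+1); last first.
    by rewrite -(card_pencil xP) cardsE.
  rewrite -big_distrr -big_distrl /=.
  have -> : (\sum_(a in points F | dot a x == 0%R) (a \in s) = 4)%N.
    rewrite -s4 -(card_uniqP us) -sum1_card big_mkcond [RHS]big_mkcond.
    apply: eq_bigr => a _; have [as_|] := boolP (a \in s); last by case: (_ && _).
    by rewrite (sP _ as_) (sx _ as_) eqxx.
  rewrite (bigD1 m) /=; last by rewrite mP mx eqxx.
  by rewrite eqxx q7 => le e; move: le; rewrite e; lia_nat.
have ls : l \notin s.
  apply/negP => ls; have : rest s = set0.
    apply/setP => v; rewrite in_set0; apply/negP => vs.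
    have := subsetP rest_l v vs; move: vs; rewrite !inE => /andP[/hasPn /(_ l ls) /negPf -> //].
  by move/eqP; rewrite -cards_eq0 -/(outside w s) -/(out s) out_s.
have rest_sub : rest s \subset supp w :&: zeros (dot l) by rewrite subsetI rest_l subsetDl.
have lx : dot l x != 0.
  apply/eqP => lx; have := light l lP lx ls; rewrite extra_nil leqNgt.
  by case/negP; apply: leq_trans (subset_leq_card rest_sub); rewrite -/(outside w s) -/(out s) out_s.
(* If l had a support point v on some b in s, deleting l and the other three lines of s would leave
   at most three points, those of b other than x and v; [card_exclusive] requires q + 1 - 4 = 4. *)
have rest_eq : rest s = supp w :&: zeros (dot l).
  apply/eqP; rewrite eqEsubset rest_sub /=; apply/subsetP => v /setIP[vB vl].
  rewrite in_setD vB andbT inE; apply/negP => /hasP[b bs /eqP bv].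
  have lv : dot l v = 0 by move: vl; rewrite inE => /eqP.
  pose t := l :: rem b s.
  have tq : (size t <= q.-1)%N by rewrite /= size_rem // s4 q7.
  have sub : rest t \subset (supp w :&: zeros (dot b)) :\ x :\ v.
    apply/subsetP => u /setDP[uB]; rewrite inE /t /= negb_or => /andP[lu ru].
    have bu : dot b u = 0.
      have := subsetP cov u uB; rewrite inE /= (negPf lu) => /hasP[c cs cu].
      have [<-|cb] := eqVneq c b; first exact/eqP.
      by case/hasP: ru; exists c; rewrite // mem_rem_uniq // inE cb.
    rewrite !in_setD1 in_setI uB inE bu eqxx !andbT.
    apply/andP; split; first by apply: contraNneq lu => ->; rewrite lv.
    apply: contraNneq ru => ->; have : (0 < size (rem b s))%N by rewrite size_rem // s4.
    case e: (rem b s) => [|c r] // _; rewrite /= sx ?eqxx //.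
    by apply: (@mem_rem _ b); rewrite e mem_head.
  have bP := sP b bs; have b5 := s5 b bs.
  have xv : v != x by apply: contraNneq lx => <-; rewrite lv.
  have cb : #|(supp w :&: zeros (dot b)) :\ x :\ v| = 3%N.
    have := b5; rewrite extra_nil (cardsD1 x) (cardsD1 v (_ :\ x)) in_setD1 !in_setI xB vB xv.
    by rewrite !inE (sx b bs) bv eqxx !add1n => -[].
  have bl : b != l by apply: contraNneq ls => <-.
  have nc : ~~ (supp w \subset union_lines t).
    have : (0 < #|(supp w :&: zeros (dot b)) :\ x :\ v|)%N by rewrite cb.
    case/card_gt0P => u; rewrite !in_setD1 in_setI => /and4P[uv ux uB ub].
    have bu : dot b u = 0 by move: ub; rewrite inE => /eqP.
    have uP := subsetP wP u uB.
    apply/subsetPn; exists u => //; rewrite inE /t /= negb_or; apply/andP; split.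
      apply: contraNneq uv => lu; apply/eqP.
      exact: meet_unique bP lP bl uP (subsetP wP v vB) bu lu bv lv.
    apply/hasP => -[c]; rewrite mem_rem_uniq // inE => /andP[cb' cs] /eqP cu.
    case/negP: ux; apply/eqP.
    by apply: meet_unique bP (sP c cs) _ uP xP bu cu (sx b bs) (sx c cs); rewrite eq_sym.
  have := @card_exclusive F w q4 wP dw w3 t tq nc; rewrite /= size_rem // s4 q7 leqNgt.
  case/negP; rewrite addn4 !ltnS; apply: leq_trans (subset_leq_card sub) _.
  by rewrite cb.
have opp v : v \in rest s -> w v = - w x.
  move=> vs; have [vB vns] : v \in supp w /\ v \notin union_lines s.
    by move: vs; rewrite in_setD => /andP[].
  have vP := subsetP wP v vB.
  have [m mP [mx mv]] := line_through_exists xP vP.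
  have ms : m \notin s.
    by apply: contra vns => ms; rewrite inE; apply/hasP; exists m; rewrite // mv.
  have xv : x != v.
    by apply: contraNneq lx => ->; have := subsetP rest_l v vs; rewrite inE.
  have e : [set x; v] = supp w :&: zeros (dot m).
    apply/eqP; rewrite eqEcard cards2 xv -extra_nil light // andbT.
    by apply/subsetP => u; rewrite in_set2 in_setI => /orP[] /eqP ->; rewrite ?xB ?vB inE ?mx ?mv eqxx.
  have := line_sum mP; rewrite -e big_setU1 /=; last by rewrite in_set1.
  by rewrite big_set1 addrC => /eqP; rewrite addr_eq0 => /eqP.
have := line_sum lP; rewrite -rest_eq (eq_bigr (fun=> - w x)) //.
rewrite sumr_const -/(outside w s) -/(out s) out_s mulNrn => /eqP; rewrite oppr_eq0.
have x0 : w x != 0 by rewrite inE in xB.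
rewrite -mulr_natr mulf_eq0 (negPf x0) /= => /eqP e4.
have e7 : 7%:R = 0 :> F by rewrite -q7 natr_card_eq0.
have : 2%:R * 4%:R - 7%:R = 1 :> F by ring.
by rewrite e4 e7 mulr0 subr0 => /esym/eqP; rewrite oner_eq0.
Qed.

(** If any two five-point lines meet in a support point, [heavy_meet] bounds their number above and
    [card_heavy] below. For 8 <= q <= 10 the pencil bound, m + 1 being the integer part of (2q -
    2)/3, already conflicts. For q = 7 it only gives 16 against 12; excluding four concurrent lines
    lowers 16 to 11. *)
Lemma cover_max5 : (6 < q)%N -> (forall b, b \in points F -> (extra [::] b <= 5)%N) ->
  three_lines w.
Proof.
move=> q6 max5; have q10 := max5_card max5; have ch := card_heavy max5.
have [/existsP[a /existsP[b /and3P[ah bh ab]]]|/existsPn h] :=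
  boolP [exists a : V, [exists b : V, [&& a \in heavy, b \in heavy & extra [:: a] b == 5%N]]].
  have [/heavyP[aP a5] /heavyP[bP b5]] := (ah, bh).
  exact: disjoint_pair aP bP q6 a5 (eqP ab).
exfalso.
have meets a b : a \in heavy -> b \in heavy -> b != a -> (extra [:: a] b < 5)%N.
  move=> ah bh ba; have := h a; rewrite negb_exists => /forallP/(_ b).
  rewrite ah bh /= => n5; rewrite ltn_neqAle n5 /=.
  by have /heavyP[_ <-] := bh; apply: extra_le.
have /card_gt0P[a ah] : (0 < #|heavy|)%N by rewrite -mulnn in ch; nia.
have bound (m : nat) : (forall x, x \in supp w -> dot a x = 0 ->
    (#|[set b in heavy | dot b x == 0%R]| <= m.+1)%N) -> (#|heavy| <= (5 * m).+1)%N.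
  by apply: heavy_meet => // b; apply: meets.
have pencil x : x \in supp w -> (3 * #|[set b in heavy | dot b x == 0%R]| + 2 * q.+1 <= 4 * q)%N.
  exact: heavy_pencil.
have [q7|q7] := eqVneq q 7.
  have [/existsP[x /and3P[xB ax]]|/existsPn few] := boolP [exists x : V,
    [&& x \in supp w, dot a x == 0 & (3 < #|[set b in heavy | dot b x == 0%R]|)%N]].
    case/card_geqP => s [us s4 sh]; apply: (@no_four_concurrent x s q7 xB us s4) => b /sh;
    by rewrite [_ \in _]in_set => /andP[bh /eqP].
  have := bound 2 _; rewrite q7 in ch; move: ch; case: #|heavy| => // hh ch le.
  have : (hh.+1 <= 11)%N.
    by apply: le => x xB ax; have := few x; rewrite xB ax eqxx -leqNgt.
  by lia.
have := bound ((2 * q - 2) %/ 3).-1 _ => le.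
have {}le : (#|heavy| <= (5 * ((2 * q - 2) %/ 3).-1).+1)%N.
  by apply: le => x xB _; have := pencil x xB; clear -q6; move: q q6 => n n6; lia.
move: ch le q6 q7 q10; clear; move: #|heavy| => hh; move: q => n.
by case: n => [|[|[|[|[|[|[|[|[|[|[|]]]]]]]]]]] //=; lia.
Qed.

(** For q = 5 the collinearity threshold is 5 points after two deletions and 3 after three. So the
    nine points off a must lose four on one line, or three on each of two lines. *)
Lemma cover5_max6 a : q = 5%N -> a \in points F -> extra [::] a = 6%N -> three_lines w.
Proof.
move=> q5 aP a6.
have oa : out [:: a] = 9%N by have := outside1 a; rewrite a6 q5; lia_nat.
have four b : b \in points F -> (3 < extra [:: a] b)%N -> three_lines w.
  move=> bP b3; have ob := outside_cons b [:: a].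
  have s1 : (2 <= q.-1)%N by rewrite q5.
  have s2 : (out [:: b; a] <= (q.-1 - 2).*2.+1)%N by rewrite q5; lia_nat.
  have [c cP cov] := @cover_line F w wP dw [:: b; a] s1 s2.
  by exists c, b, a.
have [/existsP[b /andP[bP b3]]|/existsPn h] :=
  boolP [exists b : V, (b \in points F) && (3 < extra [:: a] b)%N]; first exact: four bP b3.
have le3 b : b \in points F -> (extra [:: a] b <= 3)%N.
  by move=> bP; have := h b; rewrite bP -leqNgt.
have ge1 b : b \in points F -> b != a -> (1 <= extra [:: a] b)%N.
  move=> bP ba; have b1 : (extra [::] b <= extra [:: a] b + 1)%N.
    by apply: (@extra_ge [:: a] b) => // [x|]; rewrite mem_seq1 // => /eqP ->.
  by have := w2 bP; rewrite -extra_nil; lia_nat.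
(* The sum of (i - 1)(i - 3) <= 0 over the lines other than a vanishes. *)
have odd b : b \in points F -> b != a -> extra [:: a] b != 2%N.
  move=> bP ba; apply/eqP => b2; have := extra_count [:: a] 4 3; rewrite oa q5.
  rewrite (bigD1 a) // (bigD1 b) /=; last by rewrite bP.
  rewrite extra_self b2; set s := \sum_(_ | _) _ => e; have : s <= 0.
    apply: Num.Theory.sumr_le0 => c /andP[/andP[cP ca] _].
    have := le3 c cP; have := ge1 c cP ca.
    by case: (extra [:: a] c) => [|[|[|[|]]]].
  by move: e; clear; move: s => s; lia.
have restn (t : seq V) : #|rest t| = out t by [].
have pencil t x : x \in rest t ->
    (\sum_(b in points F | dot b x == 0%R) extra t b = out t + 5)%N.
  by move=> xt; rewrite pencil_count_mem ?restP // q5.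
have rest_points t x : x \in rest t -> x \in points F by apply/subsetP/restP.
have cpencil x : x \in points F ->
    (\sum_(b in points F | dot b x == 0%R) 2 = 12)%N.
  by move=> xP; rewrite sum_nat_const -cardsE (card_pencil xP) q5.
(* The six lines through x total more than 7 + 5 = 12, so one of them has more than two points. *)
have heavier t x (xt : x \in rest t) : (7 < out t)%N ->
    exists2 b : V, b \in points F & dot b x = 0 /\ (2 < extra t b)%N.
  move=> t7; have [/existsP[b /and3P[bP /eqP bx b2]]|/existsPn no] :=
    boolP [exists b : V, [&& b \in points F, dot b x == 0 & (2 < extra t b)%N]]; first by exists b.
  have : (\sum_(b in points F | dot b x == 0%R) extra t b <=
          \sum_(b in points F | dot b x == 0%R) 2)%N.
    by apply: leq_sum => b /andP[bP bx]; have := no b; rewrite bP bx /= -leqNgt.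
  by rewrite pencil // cpencil ?(rest_points t) //; lia_nat.
have /card_gt0P[x xa] : (0 < #|rest [:: a]|)%N by rewrite restn oa.
have [|b bP [bx b2]] := heavier [:: a] x xa; first by rewrite oa.
have b3 : extra [:: a] b = 3%N by have := le3 b bP; lia_nat.
have ob : out [:: b; a] = 6%N by have := outside_cons b [:: a]; rewrite oa b3; lia_nat.
have /card_gt0P[y yb] : (0 < #|rest [:: b; a]|)%N by rewrite restn ob.
have ya : y \in rest [:: a].
  by move: yb; rewrite rest_cons in_setD => /andP[].
(* Otherwise a line through y, having 1 or 3 points off a, has at most 1 or 2 of them off b, so
   twice the second count is at most the first plus one. Summed over six lines this reads 2(6 + 5)
   <= (9 + 5) + 6, which is false. *)
have [c cP c3] : exists2 c : V, c \in points F & (2 < extra [:: b; a] c)%N.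
  have [/existsP[c /andP[cP c2]]|/existsPn no] :=
    boolP [exists c : V, (c \in points F) && (2 < extra [:: b; a] c)%N]; first by exists c.
  exfalso; have : (\sum_(c in points F | dot c y == 0%R) (2 * extra [:: b; a] c) <=
      \sum_(c in points F | dot c y == 0%R) (extra [:: a] c + 1))%N.
    apply: leq_sum => c /andP[cP cy].
    have ca : c != a.
      apply: contraTneq ya => ca; rewrite in_setD negb_and inE /= negbK.
      by rewrite -ca cy.
    have := no c; rewrite cP /= -leqNgt => c2.
    have le : (extra [:: b; a] c <= extra [:: a] c)%N.
      by rewrite /extra subset_leq_card // setSI // rest_cons subsetDl.
    move: (odd c cP ca) (ge1 c cP ca) c2 le; clear.
    by move: (extra [:: b; a] c) (extra [:: a] c) => m n /eqP; lia.
  rewrite -big_distrr big_split /= !pencil // ob oa.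
  rewrite sum_nat_const -cardsE (card_pencil (rest_points _ _ ya)) q5.
  by [].
have oc := outside_cons c [:: b; a].
have s1 : (3 <= q.-1)%N by rewrite q5.
have s2 : (out [:: c; b; a] <= (q.-1 - 3).*2.+1)%N by rewrite q5; lia_nat.
have [d dP cov] := @cover_line F w wP dw [:: c; b; a] s1 s2.
exact: four_lines cov.
Qed.

(** With no six-point line there are three five-point lines. They remove at least 5 + 4 + 3 of the
    15 points, and the at most three left are collinear. *)
Lemma cover5 : q = 5%N -> three_lines w.
Proof.
move=> q5.
have [/existsP[a /andP[aP /eqP a6]]|/existsPn h] :=
  boolP [exists a : V, (a \in points F) && (extra [::] a == 6%N)]; first exact: cover5_max6 a6.
have max5 b : b \in points F -> (extra [::] b <= 5)%N.
  by move=> bP; have := h b; rewrite bP /=; have := extra_le_line bP; lia_nat.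
have := card_heavy max5; rewrite q5 => ch.
have [s [us s3 sh]] : exists s : seq V, [/\ uniq s, size s = 3%N & {subset s <= heavy}].
  by apply/card_geqP; move: ch; clear; move: #|heavy| => n; lia.
case: s us s3 sh => [|a [|b [|c []]]] // us _ sh.
have /heavyP[aP a5] : a \in heavy by apply: sh; rewrite !inE eqxx.
have /heavyP[bP b5] : b \in heavy by apply: sh; rewrite !inE eqxx orbT.
have /heavyP[cP c5] : c \in heavy by apply: sh; rewrite !inE eqxx !orbT.
move: us; rewrite /= !inE !negb_or => /and3P[/andP[ab ac] bc _].
have b4 : (extra [::] b <= extra [:: a] b + 1)%N.
  apply: (@extra_ge [:: a] b) => // [x|]; rewrite mem_seq1; first by move/eqP ->.
  by rewrite eq_sym.
have c3 : (extra [::] c <= extra [:: b; a] c + 2)%N.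
  apply: (@extra_ge [:: b; a] c) => // [x|]; rewrite mem_seq2; first by case/orP => /eqP ->.
  by rewrite negb_or ![c == _]eq_sym bc.
have oa := outside1 a; have ob := outside_cons b [:: a]; have oc := outside_cons c [:: b; a].
have s1 : (3 <= q.-1)%N by rewrite q5.
have s2 : (out [:: c; b; a] <= (q.-1 - 3).*2.+1)%N by rewrite q5; lia_nat.
have [d dP cov] := @cover_line F w wP dw [:: c; b; a] s1 s2.
exact: four_lines cov.
Qed.

Theorem triangle_cover : three_lines w.
Proof.
have [q5|q5] := eqVneq q 5%N; first exact: cover5.
have q6 : (6 < q)%N by have := card_neq6; move: q5 q4; clear; move: q => n; lia.
have [/existsP[a /andP[aP a6]]|/existsPn no7] :=
  boolP [exists a : V, (a \in points F) && (6 < extra [::] a)%N]; first exact: cover_heavy aP a6.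
have max6 b : b \in points F -> (extra [::] b <= 6)%N.
  by move=> bP; have := no7 b; rewrite bP -leqNgt.
have [/existsP[a /andP[aP /eqP a6]]|/existsPn no6] :=
  boolP [exists a : V, (a \in points F) && (extra [::] a == 6%N)]; first exact: cover_max6 a6.
apply: cover_max5 => // b bP; have := no6 b; rewrite bP /=; have := max6 b bP.
by lia_nat.
Qed.

End TriangleCover.

(** * Power sums over F *)

Section PowerSums.
Variable F : finFieldType.
Local Notation V := {ffun 'I_3 -> F}.
Local Notation q := #|F|.

Lemma power_sum0 : \sum_(x : F) x ^+ 0 = 0.
Proof.
under eq_bigr do rewrite expr0.
by rewrite sumr_const -[RHS](natr_card_eq0 F).
Qed.

Lemma expf_pred_card (x : F) : x != 0 -> x ^+ q.-1 = 1.
Proof.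
move=> x0; apply: (mulfI x0); rewrite -exprS prednK ?expf_card ?mulr1 //.
exact: ltnW (finNzRing_gt1 F).
Qed.

Lemma power_sum_dvd j : (0 < j)%N -> (q.-1 %| j)%N -> \sum_(x : F) x ^+ j = -1.
Proof.
move=> j0 /dvdnP[k ej]; rewrite (bigD1 0) //= expr0n gtn_eqF // add0r.
rewrite (eq_bigr (fun=> 1)); last first.
  by move=> x x0; rewrite ej mulnC exprM expf_pred_card // expr1n.
rewrite sumr_const; apply/eqP; rewrite -addr_eq0 -mulrSr; apply/eqP.
rewrite -[RHS](natr_card_eq0 F); congr (_%:R).
rewrite -(prednK (ltnW (finNzRing_gt1 F))) -(cardC1 (0 : F)).
by congr (_.+1).
Qed.

(** Some nonzero c has c^j different from 1, since X^r - 1 with r = j mod (q - 1) cannot have q - 1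
    > r roots. The substitution x -> c x multiplies the sum by c^j. *)
Lemma power_sum_ndvd j : ~~ (q.-1 %| j)%N -> \sum_(x : F) x ^+ j = 0.
Proof.
move=> nd; pose r := (j %% q.-1)%N.
have q1 : (0 < q.-1)%N by rewrite -subn1 subn_gt0 (finNzRing_gt1 F).
have r0 : (0 < r)%N by rewrite lt0n.
have rq : (r < q.-1)%N by rewrite ltn_mod.
have [c c0 cj] : exists2 c : F, c != 0 & c ^+ j != 1.
  have [/existsP[c /andP[]]|/existsPn h] := boolP [exists c : F, (c != 0) && (c ^+ j != 1)].
    by exists c.
  have h1 (c : F) : c != 0 -> c ^+ r = 1.
    move=> c0; have := h c; rewrite c0 negbK (divn_eq j q.-1) exprD mulnC exprM.
    by rewrite expf_pred_card // expr1n mul1r => /eqP.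
  pose p : {poly F} := 'X^r - 1%:P; have sp : size p = r.+1 by apply: size_XnsubC.
  have : (size (filter (predC1 (0%R : F)) (enum F)) < size p)%N.
    apply: max_poly_roots; rewrite ?filter_uniq -?enumT ?enum_uniq //.
      by rewrite -size_poly_eq0 sp.
    apply/allP => c; rewrite mem_filter => /andP[/= c0 _].
    by rewrite rootE !hornerE h1 ?subrr.
  rewrite sp size_filter.
  have -> : count (predC1 (0%R : F)) (enum F) = q.-1.
    by rewrite -size_filter -(cardC1 (0 : F)) cardE /enum_mem -filter_predI; congr size; apply: eq_filter => x; rewrite /= !inE andbT.
  by rewrite ltnS leqNgt rq.
have e : \sum_(x : F) x ^+ j = c ^+ j * \sum_(x : F) x ^+ j.
  rewrite {1}(reindex (fun x : F => c * x)) /=; last first.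
    by exists (fun x : F => c^-1 * x) => x _; rewrite ?mulKf ?mulVKf.
  by rewrite mulr_sumr; apply: eq_bigr => x _; rewrite exprMn.
apply/eqP; move/eqP: e; rewrite -subr_eq0 -{1}[\sum_(_ : F) _]mul1r -mulrBl mulf_eq0.
by rewrite subr_eq0 eq_sym (negPf cj).
Qed.

Lemma monomial_sum (m : 'I_3 -> nat) :
  \sum_(v : V) \prod_i v i ^+ m i = \prod_i \sum_(x : F) x ^+ m i.
Proof. by rewrite bigA_distr_bigA. Qed.

Lemma meval_sum (p : {mpoly F[3]}) (k : 'I_3 -> nat) :
  \sum_(v : V) p.@[v] * \prod_i v i ^+ k i =
  \sum_(m <- msupp p) p@_m * \prod_i \sum_(x : F) x ^+ (m i + k i).
Proof.
under eq_bigr => v _ do rewrite mevalE mulr_suml.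
rewrite exchange_big; apply: eq_bigr => m _.
under eq_bigr => v _ do rewrite -mulrA.
rewrite -mulr_sumr -monomial_sum; congr (_ * _); apply: eq_bigr => v _.
by rewrite -big_split; apply: eq_bigr => i _; rewrite exprD.
Qed.

(** The Chevalley-Warning argument: every monomial has an exponent below q - 1, whose power sum
    vanishes; for exponent 0 it is q = 0 in F. *)
Lemma meval_sum_eq0 (p : {mpoly F[3]}) d : p \is d.-homog -> (d < 3 * q.-1)%N ->
  \sum_(v : V) p.@[v] = 0.
Proof.
move=> /dhomogP pd dq; have := meval_sum p (fun=> 0%N).
under eq_bigr => v _ do rewrite big1 ?mulr1 //.
move=> ->; apply: big1_seq => m /andP[_ mp]; have md : mdeg m = d := pd m mp.
have [i mi] : exists i, (m i < q.-1)%N.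
  apply/existsP; apply: contraLR dq; rewrite negb_exists => /forallP h.
  rewrite -leqNgt -md mdegE (_ : 3 * q.-1 = \sum_(i < 3) q.-1)%N.
    by rewrite leq_sum // => i _; rewrite leqNgt.
  by rewrite sum_nat_const card_ord.
rewrite (bigD1 i) //= addn0.
have -> : \sum_(x : F) x ^+ m i = 0.
  have [->|m0] := eqVneq (m i) 0%N; first exact: power_sum0.
  by apply: power_sum_ndvd; rewrite gtnNdvd // lt0n.
by rewrite mul0r mulr0.
Qed.

End PowerSums.

(** * Coefficients of vanishing forms, and linear components *)

Section Forms.
Variable F : finFieldType.
Local Notation V := {ffun 'I_3 -> F}.
Local Notation q := #|F|.
Implicit Types (a b u v x y : V) (f g l : {mpoly F[3]}).

(** Sum f times the monomial with exponents q - 1 - m_i over F^3. These are positive, so terms with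
    a zero coordinate vanish too; in the expansion only the coefficient of m survives, multiplied by
    (-1)^3. *)
Lemma mcoeff_eq0 f m : f \is (q.-1).-homog ->
  (forall v, (forall i, v i != 0) -> f.@[v] = 0) ->
  mdeg m = q.-1 -> (forall i, m i < q.-1)%N -> f@_m = 0.
Proof.
move=> /dhomogP fh f0 md ml.
have q1 : (0 < q.-1)%N by rewrite -subn1 subn_gt0 (finNzRing_gt1 F).
pose k i := (q.-1 - m i)%N.
have k0 i : (0 < k i)%N by rewrite subn_gt0.
have : \sum_(v : V) f.@[v] * \prod_i v i ^+ k i = 0.
  apply: big1 => v _; have [/forallP h|] := boolP [forall i, v i != 0].
    by rewrite f0 // mul0r.
  rewrite negb_forall => /existsP[i]; rewrite negbK => /eqP vi.
  by rewrite (bigD1 i) //= vi expr0n gtn_eqF // mul0r mulr0.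
rewrite meval_sum; have [mf|] := boolP (m \in msupp f); last by rewrite mcoeff_msupp negbK => /eqP.
rewrite (bigD1_seq m) ?msupp_uniq //= [X in _ + X]big1_seq ?addr0; last first.
  move=> m' /andP[mm' mf']; have md' : mdeg m' = q.-1 := fh m' mf'.
  suff [i ni] : exists i, ~~ (q.-1 %| m' i + k i)%N.
    by rewrite (bigD1 i) //= power_sum_ndvd // mul0r mulr0.
  apply/existsP; apply: contraNT mm'; rewrite negb_exists => /forallP h.
  have le' (m2 : 'X_{1..3}) i : mdeg m2 = q.-1 -> (m2 i <= q.-1)%N.
    by move=> <-; rewrite mdegE (bigD1 i) //= leq_addr.
  (* A surviving m' agrees with m modulo q - 1. If it differs from m, some m'_i is q - 1, so m' is a
     pure power and m would be 0. *)
  have h' i : m' i = m i \/ m' i = q.-1 /\ m i = 0%N.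
    have := h i; rewrite negbK /k => /dvdnP[t]; have := le' m' i md'; have := ml i.
    move: (m' i) (m i) (q.-1) => s r n; case: t => [|[|t]] => *; [lia|left; lia|right; nia].
  have [/existsP[i /eqP mi]|no] := boolP [exists i, m' i == q.-1]; last first.
    apply/eqP/mnmP => i; case: (h' i) => // -[e _]; case/existsP: no; exists i; exact/eqP.
  have mi0 j : m j = 0%N.
    have [->|ji] := eqVneq j i; first by case: (h' i) => [e|[//]]; have := ml i; rewrite -e mi ltnn.
    have m'j : m' j = 0%N.
      have := md'; rewrite mdegE (bigD1 i) //= mi (bigD1 j) //= => /eqP.
      by rewrite -[X in _ == X]addn0 eqn_add2l addn_eq0 => /andP[/eqP].
    by case: (h' j) => [<-//|[_ ->]].
  by move: md; rewrite mdegE big1 // => e; move: q1; rewrite -e.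
have e i : \sum_(x : F) x ^+ (m i + k i) = -1.
  have -> : (m i + k i = q.-1)%N by rewrite subnKC // ltnW.
  exact: power_sum_dvd.
under eq_bigr => i _ do rewrite e.
by rewrite prodr_const => /eqP; rewrite mulf_eq0 expf_eq0 oppr_eq0 oner_eq0 andbF orbF => /eqP.
Qed.

Lemma fermat_coeff f : f \is (q.-1).-homog ->
  (forall v, (forall i, v i != 0) -> f.@[v] = 0) ->
  exists a b c : F, f = fermat_curve q.-1 a b c.
Proof.
move=> fh f0; pose p (i : 'I_3) := (U_(i) *+ q.-1)%MM.
have q1 : (0 < q.-1)%N by rewrite -subn1 subn_gt0 (finNzRing_gt1 F).
exists f@_(p 0), f@_(p 1), f@_(p 2%:R); apply/mpolyP => m.
rewrite /fermat_curve !mcoeffD !mcoeffZ !mcoeffXn.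
have pE i j : (p i == p j) = (i == j).
  apply/eqP/eqP => [/mnmP/(_ i)|->//]; rewrite !mulmnE !mnm1E eqxx mul1n.
  by case: (eqVneq j i) => // _; rewrite mul0n => e; move: q1; rewrite e.
rewrite -!/(p _).
have [/existsP[i /eqP <-]|/existsPn mp] := boolP [exists i, p i == m].
  by elim/ord3_ind: i; rewrite !pE /= !(mulr1, mulr0, add0r, addr0).
rewrite !(negPf (mp _)) !mulr0 !addr0.
have [md|] := eqVneq (mdeg m) q.-1; last exact: dhomog_nemf_coeff fh.
apply: mcoeff_eq0 => // i; rewrite ltnNge; apply: contra (mp i) => mi.
have m0 j : j != i -> m j = 0%N.
  move=> ji; apply/eqP; rewrite -leqn0; move: md; rewrite mdegE (bigD1 i) //= (bigD1 j) //=.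
  by move: mi; move: (m i) (m j) (q.-1) => *; lia.
apply/eqP/mnmP => j; rewrite mulmnE mnm1E; have [<-|ij] := eqVneq i j.
  by rewrite mul1n -md mdegE (bigD1 i) //= big1 ?addn0 // => j' /m0.
by rewrite mul0n m0 // eq_sym.
Qed.

Lemma meval_fermat e (a b c : F) v :
  (fermat_curve e a b c).@[v] = a * v 0 ^+ e + b * v 1 ^+ e + c * v 2%:R ^+ e.
Proof. by rewrite /fermat_curve !mevalD !mevalZ !rmorphXn /= !mevalXU. Qed.

Definition linear_form a : {mpoly F[3]} := \sum_(i < 3) a i *: 'X_i.

Lemma meval_linear_form a v : (linear_form a).@[v] = dot a v.
Proof. by rewrite raddf_sum /=; apply: eq_bigr => i _; rewrite mevalZ mevalXU. Qed.

Lemma linear_form_homog a : linear_form a \is 1.-homog.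
Proof. by rewrite rpred_sum // => i _; rewrite rpredZ // dhomogX; apply/eqP/mdeg1. Qed.

Lemma comp_homog d f (s : 3.-tuple {mpoly F[3]}) : f \is d.-homog ->
  (forall i, tnth s i \is 1.-homog) -> f \mPo s \is d.-homog.
Proof.
move=> /dhomogP fh sh; rewrite comp_mpolyE big_seq rpred_sum // => m mf; rewrite rpredZ //.
have <- : mdeg m = d := fh m mf; rewrite mdegE.
apply: (big_rec2 (fun (p : {mpoly F[3]}) n => p \is n.-homog)); first exact: dhomog1.
by move=> i n p _ ph; apply: dhomogM => //; rewrite -[X in X.-homog]mul1n; apply: dhomogMn.
Qed.

(** Substitution respects congruence modulo l, checked monomial by monomial. *)
Lemma comp_mod_linear f l (s : 3.-tuple {mpoly F[3]}) :
  (forall i, exists g, tnth s i = 'X_i + l * g) -> exists g, f \mPo s = f + l * g.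
Proof.
move=> sE; suff [g eg] : exists g, \sum_(m <- msupp f) (f@_m *: \prod_(i < 3) tnth s i ^+ m i) =
    \sum_(m <- msupp f) (f@_m *: 'X_[m]) + l * g.
  by exists g; rewrite comp_mpolyE eg -mpolyE.
apply: (big_rec2 (fun x y : {mpoly F[3]} => exists g, x = y + l * g)).
  by exists 0; rewrite mulr0 addr0.
move=> m x y _ [g ->]; rewrite mpolyXE_id.
suff [h ->] : exists h, \prod_(i < 3) tnth s i ^+ m i = \prod_(i < 3) 'X_i ^+ m i + l * h.
  by exists (f@_m *: h + g); rewrite scalerDr mulrDr -scalerAr; ring.
apply: (big_rec2 (fun x y : {mpoly F[3]} => exists g, x = y + l * g)).
  by exists 0; rewrite mulr0 addr0.
move=> i x' y' _ [g' ->]; have [g2 e2] := sE i.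
suff [h ->] : exists h, tnth s i ^+ m i = 'X_i ^+ m i + l * h.
  by exists (h * y' + 'X_i ^+ m i * g' + l * h * g'); ring.
elim: (m i) => [|k [h eh]]; first by exists 0; rewrite !expr0 mulr0 addr0.
by exists (g2 * 'X_i ^+ k + 'X_i * h + l * g2 * h); rewrite !exprS eh e2; ring.
Qed.

(* The substitution v |-> v - a(v) e with a(e) = 1 projects onto the line a = 0
   and is the identity modulo the linear form of a. *)
Lemma linear_component f a : (0 < q.-1)%N -> f \is (q.-1).-homog -> a != 0 ->
  (forall v, dot a v = 0 -> f.@[v] = 0) -> has_Fq_linear_component f.
Proof.
move=> q1 fh a0 f0; have [e ae] := dot_neq0 a0.
pose s : 3.-tuple {mpoly F[3]} := [tuple 'X_i - e i *: linear_form a | i < 3].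
have sE i : tnth s i = 'X_i - e i *: linear_form a by rewrite tnth_mktuple.
have [|g eg] := @comp_mod_linear f (linear_form a) s.
  by move=> i; exists (- (e i)%:MP); rewrite sE mulrN mulrC mul_mpolyC.
have sh : f \mPo s \is (q.-1).-homog.
  apply: comp_homog => // i; rewrite sE rpredB ?rpredZ ?linear_form_homog //.
  by rewrite dhomogX; apply/eqP/mdeg1.
have s0 v : (f \mPo s).@[v] = 0.
  rewrite comp_mpoly_meval -[RHS](f0 (v + scale (- dot a v) e)).
    by apply: meval_eq => i; rewrite sE mevalB mevalXU mevalZ meval_linear_form !ffunE; ring.
  by rewrite dotDr dotZr ae mulr1 subrr.
(* A form of degree q - 1 vanishing on all of F^3 is zero: only pure powers can occur, and the unit
   vectors give their coefficients. *)
have [r [t [z fE]]] := fermat_coeff sh (fun v _ => s0 v).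
have z0 : f \mPo s = 0.
  have := s0 (vec3 1 0 0); have := s0 (vec3 0 1 0); have := s0 (vec3 0 0 1).
  rewrite fE !meval_fermat !vec3E !expr1n !expr0n gtn_eqF // !(mulr0, mulr1, addr0, add0r).
  by rewrite /fermat_curve => -> -> ->; rewrite !scale0r !addr0.
exists (linear_form a), (- g); split; last split.
- apply: contraTneq (oner_neq0 F) => la; rewrite -ae -meval_linear_form la meval0.
  by rewrite negbK.
- exact: linear_form_homog.
- by rewrite mulrN; apply/eqP; rewrite -addr_eq0 -eg z0.
Qed.

End Forms.

(** * Vertices of a covering triangle *)

Section Vertices.
Variable F : finFieldType.
Local Notation V := {ffun 'I_3 -> F}.
Implicit Types (a b c m v x : V).
Variable w : {ffun V -> F}.
Hypothesis q4 : (4 < #|F|)%N.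
Hypothesis wP : supp w \subset points F.
Hypothesis w2 : forall a, a \in points F -> (1 < #|supp w :&: zeros (dot a)|)%N.

(** A fourth line through x has two support points, found only at x and on c. So x is one of them,
    and c cannot pass through x. *)
Lemma triangle_vertex a b c x : a \in points F -> b \in points F -> c \in points F ->
  supp w \subset union_lines [:: a; b; c] -> x \in points F -> dot a x = 0 -> dot b x = 0 ->
  x \in supp w /\ dot c x != 0.
Proof.
move=> aP bP cP cov xP ax bx.
have [m [mP mx]] := fresh_line (s := [:: a; b; c]) xP (ltnW (ltnW q4)).
rewrite !in_cons in_nil orbF !negb_or => /and3P[ma mb mc].
have onx l : l \in points F -> m != l -> dot l x = 0 ->
    forall v, v \in supp w -> dot m v = 0 -> dot l v = 0 -> v = x.
  move=> lP ml lx v vB mv lv; exact: meet_unique mP lP ml (subsetP wP v vB) xP mv lv mx lx.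
have small y : ~~ (supp w :&: zeros (dot m) \subset [set y]).
  by apply: contraL (w2 mP) => /subset_leq_card; rewrite cards1 -leqNgt.
split.
  apply: contraT => xB; have [y yP yE] := meet mP cP mc.
  case/negP: (small y); apply/subsetP => v /setIP[vB]; rewrite in_set1 inE => /eqP mv.
  have vx : v != x by apply: contraNneq xB => <-.
  have := subsetP cov v vB; rewrite inE /= orbF => /or3P[] /eqP lv.
  - by case/eqP: vx; apply: (onx a).
  - by case/eqP: vx; apply: (onx b).
  - by rewrite -(yE v (subsetP wP v vB)) mv lv eqxx.
apply/eqP => cx; case/negP: (small x).
apply/subsetP => v /setIP[vB]; rewrite in_set1 inE => /eqP mv; apply/eqP.
have := subsetP cov v vB; rewrite inE /= orbF => /or3P[] /eqP lv.
- exact: (onx a).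
- exact: (onx b).
- exact: (onx c).
Qed.

End Vertices.

(** * The weight defined by the curve *)

Section CurveWeight.
Variable F : finFieldType.
Local Notation V := {ffun 'I_3 -> F}.
Local Notation q := #|F|.
Implicit Types (a b c u v x : V) (p f : {mpoly F[3]}).

Lemma meval_scale d p (r : F) v : p \is d.-homog -> p.@[scale r v] = r ^+ d * p.@[v].
Proof.
move=> /dhomogP ph; rewrite !mevalE mulr_sumr big_seq [RHS]big_seq; apply: eq_bigr => m mp.
have <- : mdeg m = d := ph m mp.
rewrite mdegE -prodrXr mulrCA -big_split; congr (_ * _); apply: eq_bigr => i _.
by rewrite ffunE exprMn.
Qed.

Lemma meval0_homog d p : (0 < d)%N -> p \is d.-homog -> p.@[(0 : V)] = 0.
Proof.
move=> d0 ph; have -> : (0 : V) = scale 0 0 by apply/ffunP => i; rewrite !ffunE mul0r.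
by rewrite (meval_scale _ _ ph) expr0n gtn_eqF // mul0r.
Qed.

(** Every point has q - 1 nonzero multiples, and q - 1 = -1 in F. *)
Lemma sum_points (G : V -> F) : G 0 = 0 ->
  (forall r v, r != 0 -> G (scale r v) = G v) -> \sum_(v in points F) G v = - \sum_v G v.
Proof.
move=> G0 Gs.
have q1 : (0 < q)%N := ltnW (finNzRing_gt1 F).
have eZ : [set scale p.1 p.2 | p in setX [set~ (0 : F)] (points F)] = [set~ (0 : V)].
  apply/setP => v; rewrite in_setC1; apply/imsetP/idP => [[[r u]]|v0].
    rewrite in_setX in_setC1 => /andP[r0 /points_neq0 u0] ->.
    by rewrite scale_eq0 negb_or r0.
  have [r [u [r0 uP ->]]] := normalize v0.
  by exists (r, u); rewrite // in_setX in_setC1 r0.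
rewrite [in RHS](bigD1 (0 : V)) //= G0 add0r.
rewrite [in RHS](eq_bigl (fun v => v \in [set~ (0 : V)])); last by move=> v; rewrite in_setC1.
rewrite -eZ big_imset /=; last exact: scale_inj (subxx _).
rewrite [in RHS](eq_bigl (fun p : F * V => (p.1 \in [set~ (0 : F)]) && (p.2 \in points F))); last first.
  by case=> r u; rewrite in_setX.
rewrite -(pair_big (mem [set~ (0 : F)]) (mem (points F)) (fun r u => G (scale r u))) /=.
rewrite [in RHS](eq_bigr (fun=> \sum_(v in points F) G v)); last first.
  by move=> r; rewrite in_setC1 => r0; apply: eq_bigr => v _; rewrite Gs.
rewrite sumr_const cardsC1 -mulr_natl.
have -> : q.-1%:R = -1 :> F.
  by apply/eqP; rewrite -addr_eq0 -mulrSr prednK // natr_card_eq0.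
by rewrite mulN1r opprK.
Qed.

Lemma sum_points_homog d p : p \is d.-homog -> (q.-1 %| d)%N -> (0 < d < 3 * q.-1)%N ->
  \sum_(v in points F) p.@[v] = 0.
Proof.
move=> ph /dvdnP[k ed] /andP[d0 dq]; rewrite sum_points.
- by rewrite (meval_sum_eq0 ph dq) oppr0.
- exact: meval0_homog ph.
by move=> r v r0; rewrite (meval_scale _ _ ph) ed mulnC exprM expf_pred_card // expr1n mul1r.
Qed.

Lemma dep_products k (w : {ffun V -> F}) :
  (forall s : seq V, size s = k -> \sum_v (\prod_(a <- s) dot a v) * w v = 0) -> dep k w.
Proof.
elim: k w => [|k IH] w h /=.
  by rewrite -[RHS](h [::]) //; apply: eq_bigr => v _; rewrite big_nil mul1r.
move=> a; apply: IH => s ss; rewrite -[RHS](h (a :: s)) /= ?ss //.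
by apply: eq_bigr => v _; rewrite big_cons ffunE; ring.
Qed.

Definition curve_weight f : {ffun V -> F} := [ffun v => if v \in points F then f.@[v] else 0].

Lemma sum_curve_weight f (G : V -> F) :
  \sum_v G v * curve_weight f v = \sum_(v in points F) G v * f.@[v].
Proof.
rewrite [RHS]big_mkcond; apply: eq_bigr => v _; rewrite ffunE.
by case: (v \in points F); rewrite ?mulr0.
Qed.

Variable f : {mpoly F[3]}.
Hypothesis fh : f \is (q.-1).-homog.
Let w := curve_weight f.

Lemma supp_curve_weight : supp w \subset points F.
Proof. by apply/subsetP => v; rewrite inE ffunE; case: ifP => //; rewrite eqxx. Qed.

Lemma mem_supp_curve v : v \in points F -> (v \in supp w) = (f.@[v] != 0).
Proof. by move=> vP; rewrite inE ffunE vP. Qed.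

Let q1 : (0 < q.-1)%N.
Proof. by rewrite -subn1 subn_gt0 (finNzRing_gt1 F). Qed.

(** The product of f and q - 1 linear forms has degree 2(q - 1), which is below 3(q - 1) and a
    multiple of q - 1, so values do not depend on the chosen representatives. *)
Lemma dep_curve_weight : dep q.-1 w.
Proof.
apply: dep_products => s ss; rewrite sum_curve_weight.
pose p := \prod_(a <- s) linear_form a * f.
have ph : p \is (q.-1 + q.-1).-homog.
  apply: dhomogM => //; rewrite -ss; elim: s {ss p} => [|a s IH]; rewrite ?big_nil ?big_cons.
    exact: dhomog1.
  exact: dhomogM (linear_form_homog a) IH.
rewrite -[RHS](sum_points_homog ph) ?dvdn_add //; last by lia_nat.
apply: eq_bigr => v _; rewrite mevalM rmorph_prod; congr (_ * _).
by apply: eq_bigr => a _; rewrite /= meval_linear_form.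
Qed.

(** With l the form of a, l^(q - 1) is 0 on the line and 1 off it: f - f l^(q - 1) restricts f to
    the line, and both terms sum to zero. *)
Lemma line_sum_curve_weight a : \sum_(v | dot a v == 0) w v = 0.
Proof.
pose p := f * linear_form a ^+ q.-1.
have ph : p \is (q.-1 + q.-1).-homog.
  apply: dhomogM => //; rewrite -[X in X.-homog]mul1n; apply: dhomogMn.
  exact: linear_form_homog.
have e1 : \sum_(v in points F) p.@[v] = 0.
  by apply: sum_points_homog ph _ _; rewrite ?dvdn_add //; lia_nat.
have e2 : \sum_(v in points F) f.@[v] = 0.
  by apply: sum_points_homog fh _ _; rewrite ?dvdnn //; lia_nat.
transitivity (\sum_(v in points F) f.@[v] - \sum_(v in points F) p.@[v]); last by rewrite e1 e2 subrr.
rewrite -sumrB big_mkcond [RHS]big_mkcond; apply: eq_bigr => v _.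
rewrite ffunE; case: (v \in points F); last by case: ifP.
rewrite mevalM rmorphXn /= meval_linear_form; case: (eqVneq (dot a v) 0) => [->|av].
  by rewrite expr0n gtn_eqF // mulr0 subr0.
by rewrite expf_pred_card // mulr1 subrr.
Qed.

(** One nonzero value alone cannot sum to zero, and if there is none, [linear_component] makes the
    line a component. *)
Lemma card_line_curve a : ~ has_Fq_linear_component f -> a \in points F ->
  (1 < #|supp w :&: zeros (dot a)|)%N.
Proof.
move=> nolin aP; have := line_sum_curve_weight a.
have -> : \sum_(v | dot a v == 0) w v = \sum_(v in supp w :&: zeros (dot a)) w v.
  rewrite big_mkcond [RHS]big_mkcond; apply: eq_bigr => v _.
  by rewrite !inE; have [->|] := eqVneq (w v) 0 => //=; case: (dot a v == 0).
case: ltngtP => // [|/esym/eqP/cards1P[v ev]].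
  rewrite ltnS leqn0 cards_eq0 => /eqP e0 _; case: nolin.
  apply: (linear_component q1 fh (points_neq0 aP)) => v av.
  have [->|v0] := eqVneq v 0; first exact: meval0_homog fh.
  have [r [u [r0 uP eu]]] := normalize v0; rewrite eu (meval_scale _ _ fh).
  have : u \notin supp w :&: zeros (dot a) by rewrite e0 in_set0.
  rewrite in_setI mem_supp_curve // inE => h; have au : dot a u = 0.
    by move/eqP: av; rewrite eu dotZr mulf_eq0 (negPf r0) => /eqP.
  by move: h; rewrite au eqxx andbT negbK => /eqP ->; rewrite mulr0.
rewrite ev big_set1 => wv; have : v \in supp w :&: zeros (dot a) by rewrite ev set11.
by rewrite in_setI inE wv eqxx.
Qed.

(** 3q = (q^2 + q + 1) - (q - 1)^2. *)
Lemma card_supp_curve : (1 < q.-1)%N -> Nq f = (q.-1 ^ 2)%N -> #|supp w| = (3 * q)%N.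
Proof.
move=> q2; rewrite /Nq; set Z := [set v | _].
have Z0 : 0 \notin Z by rewrite inE eqxx.
have Zs r v : r != 0 -> v \in Z -> scale r v \in Z.
  move=> r0; rewrite !inE => /andP[v0 /eqP fv].
  by rewrite scale_eq0 negb_or r0 v0 (meval_scale _ _ fh) fv mulr0 eqxx.
rewrite (card_scale_closed Z0 Zs) subn1 mulKn // => cZ.
have -> : supp w = points F :\: (Z :&: points F).
  apply/setP => v; rewrite in_setD in_setI.
  case: (boolP (v \in points F)) => [vP|vP]; last first.
    by rewrite andbF; apply/negP => /(subsetP supp_curve_weight); apply/negP.
  by rewrite !andbT mem_supp_curve // [v \in Z]inE (points_neq0 vP).
rewrite cardsD (setIidPr (subsetIr _ _)) cZ card_points_eq.
by move: q1; clear; move: q => [|n] //= _; rewrite -!mulnn; lia.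
Qed.

End CurveWeight.

(** * Coordinates adapted to the triangle *)

Lemma line_matrix_unit (F : finFieldType) (L : 'I_3 -> {ffun 'I_3 -> F}) :
  (forall x, x \in points F -> ~ forall i, dot (L i) x = 0) ->
  \matrix_(i, j) L i j \in unitmx.
Proof.
move=> nc; rewrite unitmxE unitfE -det_tr; apply/det0P => -[v v0 vA].
have [|r [x [r0 xP ex]]] := @normalize F [ffun i => v 0 i].
  apply: contraNneq v0 => /ffunP v0; apply/eqP/rowP => i.
  by have := v0 i; rewrite !ffunE mxE.
apply: (nc x xP) => i; apply/(mulfI r0); rewrite -dotZr -ex mulr0.
have := congr1 (fun w : 'rV_3 => w 0 i) vA; rewrite !mxE => <-.
by apply: eq_bigr => j _; rewrite !mxE ffunE mulrC.
Qed.

Theorem theorem4p4 (F : finFieldType) (f : {mpoly F[3]}) :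
  (5 <= #|F|)%N ->
  plane_curve (#|F|.-1) f ->
  ~ has_Fq_linear_component f ->
  Nq f = (#|F|.-1 ^ 2)%N ->
  exists a b c : F,
    [/\ a != 0, b != 0, c != 0, a + b + c = 0 &
        proj_equiv f (fermat_curve (#|F|.-1) a b c)].
Proof.
move=> q5 [_ fh] nolin nq; pose w := curve_weight f.
have q2 : (1 < #|F|.-1)%N by rewrite -ltnS prednK; [exact: ltn_trans q5|exact: leq_trans q5].
have wP : supp w \subset points F := supp_curve_weight f.
have w2 := fun a (aP : a \in points F) => card_line_curve fh nolin aP.
have [a [b [c [aP bP cP cov]]]] : three_lines w.
  apply: triangle_cover => //.
  - exact: dep_curve_weight.
  - exact: card_supp_curve.
  - by move=> a _; apply: line_sum_curve_weight.
have covb : supp w \subset union_lines [:: b; c; a].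
  by apply: union_linesS cov; rewrite /= !inE !eqxx ?orbT.
have covc : supp w \subset union_lines [:: a; c; b].
  by apply: union_linesS cov; rewrite /= !inE !eqxx ?orbT.
have vertex := triangle_vertex q5 wP w2.
pose L (i : 'I_3) := nth 0 [:: a; b; c] i.
have Au : \matrix_(i, j) L i j \in unitmx.
  apply: line_matrix_unit => x xP Lx.
  have [_] := vertex a b c x aP bP cP cov xP (Lx 0) (Lx 1).
  by case/eqP; apply: (Lx 2%:R).
set A := (\matrix_(i, j) L i j) in Au.
(* This substitution turns the three lines into the coordinate lines: the i-th one takes the value
   v_i at [u v]. *)
pose M := invmx A; pose g := proj_transform M f.
pose u (v : {ffun 'I_3 -> F}) : {ffun 'I_3 -> F} := [ffun i => \sum_j M i j * v j].
have Lu i v : dot (L i) (u v) = v i.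
  transitivity ((A *m (M *m \col_j v j)) i 0); last by rewrite mulKVmx // mxE.
  by rewrite mxE; apply: eq_bigr => j _; rewrite !mxE ffunE; congr (_ * _); apply: eq_bigr => k _; rewrite mxE.
have gE (v : {ffun 'I_3 -> F}) : g.@[v] = f.@[u v].
  rewrite comp_mpoly_meval; apply: meval_eq => i; rewrite tnth_mktuple raddf_sum /= ffunE.
  by apply: eq_bigr => j _; rewrite mevalZ mevalXU.
have gh : g \is (#|F|.-1).-homog.
  apply: comp_homog => // i; rewrite tnth_mktuple rpred_sum // => j _.
  by rewrite rpredZ // dhomogX; apply/eqP/mdeg1.
have g0 (v : {ffun 'I_3 -> F}) : (forall i, v i != 0) -> g.@[v] = 0.
  move=> v0; rewrite gE; have [|r [x [r0 xP ex]]] := @normalize F (u v).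
    by apply: contraNneq (v0 0) => u0; rewrite -Lu u0 dot0r.
  suff : x \notin supp w by rewrite ex (meval_scale _ _ fh) mem_supp_curve // negbK => /eqP ->; rewrite mulr0.
  apply/negP => /(subsetP cov); rewrite inE /= orbF.
  have Lx i : dot (L i) x != 0.
    by have := v0 i; rewrite -Lu ex dotZr mulf_eq0 (negPf r0).
  by rewrite (negPf (Lx 0)) (negPf (Lx 1)) (negPf (Lx 2%:R)).
(* A nonzero v on two of the lines represents a vertex, which is in the support. *)
have g1 (v l m n : {ffun 'I_3 -> F}) : l \in points F -> m \in points F -> n \in points F ->
    supp w \subset union_lines [:: l; m; n] -> dot l (u v) = 0 -> dot m (u v) = 0 ->
    v != 0 -> g.@[v] != 0.
  move=> lP mP nP covl lu mu v0; rewrite gE; have [|r [x [r0 xP ex]]] := @normalize F (u v).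
    by apply: contraNneq v0 => u0; apply/eqP/ffunP => i; rewrite -Lu u0 dot0r ffunE.
  have xw : x \in supp w.
    apply: (vertex l m n x lP mP nP covl xP _ _).1.
      by move/eqP: lu; rewrite ex dotZr mulf_eq0 (negPf r0) => /eqP.
    by move/eqP: mu; rewrite ex dotZr mulf_eq0 (negPf r0) => /eqP.
  rewrite mem_supp_curve // in xw.
  by rewrite ex (meval_scale _ _ fh) mulf_neq0 // expf_neq0.
have [r [s [t gF]]] := fermat_coeff gh g0.
have e0 : (0 ^+ #|F|.-1 = 0 :> F) by rewrite expr0n gtn_eqF // ltnW.
have vec0 (x y z : F) i : vec3 x y z i != 0 -> vec3 x y z != 0.
  by apply: contraNneq => ->; rewrite ffunE.
(* The unit vectors are the vertices, so the coefficients are nonzero; (1, 1, 1) is off the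
   triangle, so their sum is zero. *)
exists r, s, t; split.
- have := g1 (vec3 1 0 0) b c a bP cP aP covb; rewrite (Lu 1) (Lu 2%:R) gF meval_fermat !vec3E.
  rewrite e0 expr1n !mulr0 mulr1 !addr0; apply=> //.
  by apply: (vec0 _ _ _ 0); rewrite vec3E oner_eq0.
- have := g1 (vec3 0 1 0) a c b aP cP bP covc; rewrite (Lu 0) (Lu 2%:R) gF meval_fermat !vec3E.
  rewrite e0 expr1n !mulr0 mulr1 addr0 add0r; apply=> //.
  by apply: (vec0 _ _ _ 1); rewrite vec3E oner_eq0.
- have := g1 (vec3 0 0 1) a b c aP bP cP cov; rewrite (Lu 0) (Lu 1) gF meval_fermat !vec3E.
  rewrite e0 expr1n !mulr0 mulr1 !add0r; apply=> //.
  by apply: (vec0 _ _ _ 2%:R); rewrite vec3E oner_eq0.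
- have := g0 (vec3 1 1 1); rewrite gF meval_fermat !vec3E expr1n !mulr1; apply.
  by apply: ord3_ind; rewrite vec3E oner_eq0.
- exists M, 1; split; first by rewrite unitmx_inv.
  by split; [exact: oner_neq0 | rewrite scale1r -gF].
Qed.
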